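(* For any $\mathbf v\in\mathcal H(0)$, there exists a unique critical solution $\mathbf u$, i.e. a unique viscosity solution $\mathbf u\in(C(\mathbb T^N))^m$ of $$H_i(x,Du_i)+\big(B(x)\mathbf u(x)\big)_i=0\quad\text{in }\mathbb T^N,\qquad i\in\{1,\dots,m\},$$ such that $\mathbf u=\mathbf v$ on $\mathcal A$.
   Context: Let $N,m$ be positive integers, $\mathbb T^N=\mathbb R^N/\mathbb Z^N$ the flat torus. A convex Hamiltonian is a continuous $H:\mathbb T^N\times\mathbb R^N\to\mathbb R$ such that $p\mapsto H(x,p)$ is convex for every $x$ and there are $\alpha,\beta:\mathbb R_+\to\mathbb R$ tending to $+\infty$ at $+\infty$ with $\alpha(|p|)\leqslant H(x,p)\leqslant\beta(|p|)$ for all $(x,p)$. Let $H_1,\dots,H_m$ be convex Hamiltonians. An $m\times m$ real matrix $(b_{ij})$ is a coupling matrix if $b_{ij}\leqslant0$ for $j\ne i$ and $\sum_j b_{ij}\geqslant0$ for every $i$; it is degenerate if moreover $\sum_j b_{ij}=0$ for every $i$; a matrix is irreducible if for every nonempty $\mathcal I\subsetneq\{1,\dots,m\}$ there are $i\in\mathcal I$, $j\notin\mathcal I$ with $b_{ij}\neq0$. Let $B(x)=(b_{ij}(x))$ have continuous coefficients on $\mathbb T^N$ and be an irreducible degenerate coupling matrix for every $x$. Write $(B(x)\mathbf u(x))_i=\sum_j b_{ij}(x)u_j(x)$. For continuous $u$, $D^+u(x_0)$ (resp. $D^-u(x_0)$) is the set of $D\phi(x_0)$ with $\phi$ of class $C^1$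 near $x_0$ and $u-\phi$ having a local maximum (resp. minimum) at $x_0$. For $a\in\mathbb R$, $\mathbf u\in(C(\mathbb T^N))^m$ is a (viscosity) subsolution [resp. supersolution] of $H_i(x,Du_i)+(B(x)\mathbf u(x))_i=a$ in $\mathbb T^N$, $i=1,\dots,m$, if for all $x$ and $i$: $H_i(x,p)+(B(x)\mathbf u(x))_i\leqslant a$ for all $p\in D^+u_i(x)$ [resp. $\geqslant a$ for all $p\in D^-u_i(x)$]; a solution is both. $\mathcal H(a)$ denotes the set of subsolutions. The critical value is $c=\inf\{a\in\mathbb R:\mathcal H(a)\neq\varnothing\}$; it is assumed, by normalization, that $c=0$. ''Critical'' sub/super/solutions refer to $a=0$. For $x,y\in\mathbb T^N$, $i,j\in\{1,\dots,m\}$ set $\Phi_{i,j}(y,x)=\sup_{\mathbf v\in\mathcal H(0)}\big(v_i(x)-v_j(y)\big)$, and let $\Phi_{\cdot,j}(y,\cdot)=(\Phi_{1,j}(y,\cdot),\dots,\Phi_{m,j}(y,\cdot))^T$. The Aubry set is $\mathcal A=\{y\in\mathbb T^N:\Phi_{\cdot,i}(y,\cdot)\text{ is a critical solution}\}$, where $i$ is any fixed index (the set does not depend on $i$). *)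

(* Defs.v *)
From HB Require Import structures.
From mathcomp Require Import all_boot all_order all_algebra.
From mathcomp Require Import all_classical all_reals all_analysis.
Set Implicit Arguments.
Unset Strict Implicit.
Unset Printing Implicit Defensive.
Import Order.TTheory GRing.Theory Num.Theory.
Import numFieldNormedType.Exports.
Local Open Scope classical_set_scope.
Local Open Scope ring_scope.

(* Functions on the flat torus R^N / Z^N are represented by their lifts to R^N,
   i.e. by functions having every vector of the canonical basis as a period;
   likewise a subset of the torus is given by its preimage in R^N. *)
Definition torus_fun (R : realType) (N : nat) (V : zmodType)
    (f : 'rV[R]_N -> V) : Prop :=
  forall k : 'I_N, periodic f (delta_mx 0 k).

(* The library norm on 'rV[R]_N is the sup norm, hence this definition. *)
Definition euclidean_norm (R : realType) (N : nat) (p : 'rV[R]_N) : R :=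
  Num.sqrt (\sum_(k < N) p 0 k ^+ 2).

Definition convex_hamiltonian (R : realType) (N : nat)
    (H : 'rV[R]_N -> 'rV[R]_N -> R) : Prop :=
  [/\ (forall p, torus_fun (H^~ p)),
      continuous (fun z : 'rV[R]_N * 'rV[R]_N => H z.1 z.2),
      (forall x, convex_function setT (H x)) &
      exists alpha beta : R -> R,
        [/\ alpha r @[r --> +oo] --> +oo,
            beta r @[r --> +oo] --> +oo &
            forall x p, alpha (euclidean_norm p) <= H x p
                        /\ H x p <= beta (euclidean_norm p)]].

Definition coupling_matrix (R : realType) (m : nat) (b : 'M[R]_m) : Prop :=
  (forall i j, j != i -> b i j <= 0) /\ (forall i, 0 <= \sum_(j < m) b i j).

Definition degenerate_coupling_matrix (R : realType) (m : nat)
    (b : 'M[R]_m) : Prop :=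
  coupling_matrix b /\ (forall i, \sum_(j < m) b i j = 0).

Definition irreducible_matrix (R : realType) (m : nat) (b : 'M[R]_m) : Prop :=
  forall I : {set 'I_m}, I != finset.set0 -> I \proper finset.setT ->
    exists i j, [/\ i \in I, j \notin I & b i j != 0].

Definition gradient (R : realType) (N : nat) (phi : 'rV[R]_N -> R)
    (x : 'rV[R]_N) : 'rV[R]_N :=
  \row_(k < N) 'd phi x (delta_mx 0 k).

Definition C1_near (R : realType) (N : nat) (phi : 'rV[R]_N -> R)
    (x0 : 'rV[R]_N) : Prop :=
  \forall y \near x0,
    differentiable phi y /\ {for y, continuous (gradient phi)}.

Definition superdifferential (R : realType) (N : nat) (u : 'rV[R]_N -> R)
    (x0 : 'rV[R]_N) : set 'rV[R]_N :=
  [set p | exists phi : 'rV[R]_N -> R,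
    [/\ C1_near phi x0,
        (\forall y \near x0, u y - phi y <= u x0 - phi x0) &
        p = gradient phi x0]].

Definition subdifferential (R : realType) (N : nat) (u : 'rV[R]_N -> R)
    (x0 : 'rV[R]_N) : set 'rV[R]_N :=
  [set p | exists phi : 'rV[R]_N -> R,
    [/\ C1_near phi x0,
        (\forall y \near x0, u x0 - phi x0 <= u y - phi y) &
        p = gradient phi x0]].

(* Membership of the tuple u = (u_1, ..., u_m) in C(T^N)^m. *)
Definition continuous_torus_tuple (R : realType) (N m : nat)
    (u : 'I_m -> 'rV[R]_N -> R) : Prop :=
  forall i, continuous (u i) /\ torus_fun (u i).

Definition coupling (R : realType) (N m : nat) (B : 'rV[R]_N -> 'M[R]_m)
    (u : 'I_m -> 'rV[R]_N -> R) (x : 'rV[R]_N) (i : 'I_m) : R :=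
  \sum_(j < m) B x i j * u j x.

Definition subsolutions (R : realType) (N m : nat)
    (H : 'I_m -> 'rV[R]_N -> 'rV[R]_N -> R) (B : 'rV[R]_N -> 'M[R]_m) (a : R) :
    set ('I_m -> 'rV[R]_N -> R) :=
  [set u | continuous_torus_tuple u /\
    forall x i p, superdifferential (u i) x p -> H i x p + coupling B u x i <= a].

Definition supersolutions (R : realType) (N m : nat)
    (H : 'I_m -> 'rV[R]_N -> 'rV[R]_N -> R) (B : 'rV[R]_N -> 'M[R]_m) (a : R) :
    set ('I_m -> 'rV[R]_N -> R) :=
  [set u | continuous_torus_tuple u /\
    forall x i p, subdifferential (u i) x p -> a <= H i x p + coupling B u x i].

Definition solutions (R : realType) (N m : nat)
    (H : 'I_m -> 'rV[R]_N -> 'rV[R]_N -> R) (B : 'rV[R]_N -> 'M[R]_m) (a : R) :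
    set ('I_m -> 'rV[R]_N -> R) :=
  subsolutions H B a `&` supersolutions H B a.

(* The infimum is taken in the extended reals because the real-valued inf has
   the default value 0 on sets that are empty or not bounded below. *)
Definition critical_value (R : realType) (N m : nat)
    (H : 'I_m -> 'rV[R]_N -> 'rV[R]_N -> R) (B : 'rV[R]_N -> 'M[R]_m) : \bar R :=
  ereal_inf [set a%:E | a in [set a : R | subsolutions H B a !=set0]].

Definition Phi (R : realType) (N m : nat)
    (H : 'I_m -> 'rV[R]_N -> 'rV[R]_N -> R) (B : 'rV[R]_N -> 'M[R]_m)
    (i j : 'I_m) (y x : 'rV[R]_N) : R :=
  sup [set v i x - v j y | v in subsolutions H B 0].

Definition aubry_set (R : realType) (N m : nat)
    (H : 'I_m -> 'rV[R]_N -> 'rV[R]_N -> R) (B : 'rV[R]_N -> 'M[R]_m)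
    (k : 'I_m) : set 'rV[R]_N :=
  [set y | solutions H B 0 (fun i x => Phi H B i k y x)].

(* Main.v *)
Require Import Defs.
From HB Require Import structures.
From mathcomp Require Import all_boot all_order all_algebra.
From mathcomp Require Import all_classical all_reals all_analysis.
From mathcomp Require Import ring lra.
Import Order.TTheory GRing.Theory Num.Theory.
Import numFieldNormedType.Exports.
Local Open Scope classical_set_scope.
Local Open Scope ring_scope.

(** Two mechanisms carry the proof. Here critical means relative to the constant
    0, and a momentum of a function at a point is an element of its
    superdifferential there, or of its subdifferential in the case of a
    supersolution.

    _Contact_ ([contact_propagation]). Suppose that all the differences
    [u i - v i] of a critical subsolution and a critical supersolution are at
    most [M] near [x], and that one of them equals [M] at [x]. Doubling the
    variables compares the two equations at each such index and bounds
    [coupling B u x i - coupling B v x i] above by 0, while the signs of the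
    coefficients and the zero row sums bound it below by 0. So all the terms
    [B x i j * (u j x - v j x - M)] vanish, irreducibility propagates the
    equality [u j x - v j x = M] to all indices, and at none of them can the
    inequality satisfied by [u] be strict near [x].

    _Bump_ ([perron_bump]). Where a critical subsolution fails the supersolution
    test for the index [i], its [i]-th component can be raised a little by means
    of the test function. The result is again a critical subsolution, and its
    [i]-th inequality is strict wherever it has been raised.

    The function [fun i x => Phi H B i k y x] is the largest critical subsolution whose
    [k]-th component vanishes at [y], so that its only possible bump raises the
    [k]-th component at [y]. It follows that [y] is outside the Aubry set if and
    only if some critical subsolution is strict at [y] in the [k]-th equation,
    or equivalently in any one equation ([not_aubry_strict],
    [strict_not_aubry]). Since the Hamiltonians are convex, convex combinations
    of critical subsolutions are critical subsolutions and keep part of the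
    strictness of each term; by compactness, strictness at each point of a
    compact set can be achieved by one subsolution ([strictableU],
    [strictable_compact]).

    An empty Aubry set would therefore give a subsolution strict everywhere in
    all equations, that is, a subsolution for a negative constant, against the
    normalization of the critical value ([aubry_set_nonempty]). In the same way,
    if [u <= v] on the Aubry set but not everywhere, mixing into [u] a
    subsolution strict where [u - v] is large produces a contact at a point of
    strictness; this comparison principle ([comparison]) gives uniqueness.

    For existence ([solution_with_trace]) one takes the supremum of the critical
    subsolutions equal to [v] on the Aubry set. It is a critical subsolution
    because critical subsolutions are equi-Lipschitz ([uniform_lipschitz],
    [sup_subsolution]), and a supersolution because a bump would be equal to it
    on the Aubry set and so would have been taken into account. *)

Set Implicit Arguments.
Unset Strict Implicit.
Unset Printing Implicit Defensive.

(** * Calculus of test functions *)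

Section Calculus.
Context {R : realType} {N : nat}.
Implicit Types (f g phi psi : 'rV[R]_N -> R) (a x y z p : 'rV[R]_N).

(** The squared Euclidean distance. Unlike the norm of row vectors, which is the
    sup norm, it is smooth, so that it can serve as a penalization. *)
Definition sqdist a x : R := \sum_(k < N) (x 0 k - a 0 k) ^+ 2.

Lemma coord_le_norm x k : `|x 0 k| <= `|x|.
Proof.
rewrite [leRHS]/Num.norm /= mx_normrE.
by apply/bigmax_geP; right => /=; exists (0, k).
Qed.

Lemma norm_le_coord x (c : R) :
  0 <= c -> (forall k, `|x 0 k| <= c) -> `|x| <= c.
Proof.
move=> c0 xc; rewrite [leLHS]/Num.norm /= mx_normrE.
by apply/bigmax_leP; split => // -[i j] _ /=; rewrite ord1.
Qed.

Lemma sqdist_ge0 a x : 0 <= sqdist a x.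
Proof. by apply: sumr_ge0 => k _; exact: sqr_ge0. Qed.

Lemma sqdistxx a : sqdist a a = 0.
Proof. by apply: big1 => k _; rewrite subrr expr0n. Qed.

Lemma norm_le_euclidean_norm p : `|p| <= euclidean_norm p.
Proof.
apply: norm_le_coord => [|k]; first exact: sqrtr_ge0.
rewrite -sqrtr_sqr ler_wsqrtr// (bigD1 k)//= lerDl.
by apply: sumr_ge0 => j _; exact: sqr_ge0.
Qed.

Lemma sqdistE a x : sqdist a x = euclidean_norm (x - a) ^+ 2.
Proof.
rewrite sqr_sqrtr; last by apply: sumr_ge0 => j _; exact: sqr_ge0.
by apply: eq_bigr => k _; rewrite !mxE.
Qed.

Lemma sqr_norm_le_sqdist a x : `|x - a| ^+ 2 <= sqdist a x.
Proof.
by rewrite sqdistE lerXn2r// ?nnegrE ?normr_ge0 ?sqrtr_ge0// norm_le_euclidean_norm.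
Qed.

Lemma is_derive_coord x v k : is_derive x v (fun y : 'rV[R]_N => y 0 k) (v 0 k).
Proof.
have dk : h^-1 *: (((fun y : 'rV[R]_N => y 0 k) \o shift x) (h *: v) - x 0 k)
    @[h --> (0 : R)^'] --> v 0 k.
  apply: cvg_near_cst.
  near=> h => /=.
  have h0 : h != 0 by near: h; exact: nbhs_dnbhs_neq.
  by rewrite !mxE addrK /GRing.scale/= mulKf.
apply: DeriveDef; first by apply/cvg_ex; exists (v 0 k).
by apply/cvg_lim.
Unshelve. all: by end_near. Qed.

Lemma differentiable_sqdist a x : differentiable (sqdist a) x.
Proof.
rewrite /sqdist.
have -> : (fun x : 'rV[R]_N => \sum_(k < N) (x 0 k - a 0 k) ^+ 2) =
   \sum_(k < N) ((fun y : 'rV[R]_N => y 0 k) - cst (a 0 k)) ^+ 2.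
  by apply/funext => y; rewrite fct_sumE.
apply: differentiable_sum => k; apply: differentiableX.
by apply: differentiableB; [exact: differentiable_coord|exact: differentiable_cst].
Qed.

Lemma addmx_coord x y k : (x + y) 0 k = x 0 k + y 0 k.
Proof. by rewrite mxE. Qed.

Lemma scalemx_coord (c : R) x k : (c *: x) 0 k = c * x 0 k.
Proof. by rewrite mxE. Qed.

Lemma gradientE phi x k : differentiable phi x ->
  gradient phi x 0 k = 'D_(delta_mx 0 k) phi x.
Proof. by move=> dphi; rewrite mxE deriveE. Qed.

Lemma gradient_sqdist a x : gradient (sqdist a) x = 2 *: (x - a).
Proof.
apply/rowP => k; rewrite gradientE; last exact: differentiable_sqdist.
have -> : sqdist a =
   \sum_(k < N) ((fun y : 'rV[R]_N => y 0 k) - cst (a 0 k)) ^+ 2.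
  by apply/funext => y; rewrite fct_sumE.
have D i := is_derive_coord x (delta_mx 0 k) i.
rewrite derive_val !mxE (bigD1 k)//= big1 => [|j jk].
  rewrite !mxE !eqxx /= /GRing.scale /= -[(_ - cst _) x]/(x 0 k - a 0 k); ring.
by rewrite !mxE eqxx (negbTE jk) /= subr0 scaler0.
Qed.

Lemma gradientD phi psi x : differentiable phi x -> differentiable psi x ->
  gradient (phi + psi) x = gradient phi x + gradient psi x.
Proof.
move=> dphi dpsi; apply/rowP => k.
rewrite (gradientE k (differentiableD dphi dpsi)).
rewrite (deriveD (diff_derivable dphi) (diff_derivable dpsi)).
rewrite -(gradientE k dphi).
rewrite -(gradientE k dpsi).
exact: esym (addmx_coord _ _ _).
Qed.

Lemma gradientZ c phi x : differentiable phi x ->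
  gradient (fun y => c * phi y) x = c *: gradient phi x.
Proof.
move=> dphi; apply/rowP => k; rewrite (gradientE k (@differentiableZ _ _ _ phi c _ dphi)).
rewrite (@deriveZ _ _ _ phi c _ _ (diff_derivable dphi)).
by rewrite -(gradientE k dphi) [RHS]scalemx_coord.
Qed.

Lemma gradient_cst c x : gradient (cst c : 'rV[R]_N -> R) x = 0.
Proof.
by apply/rowP => k; rewrite gradientE ?derive_cst ?mxE//; exact: differentiable_cst.
Qed.

Lemma differentiable_shift phi z x : differentiable phi (x - z) ->
  differentiable (fun y => phi (y - z)) x.
Proof.
by move=> dphi; apply: (@differentiable_comp _ _ _ _ (fun y => y - z) phi).
Qed.

Lemma gradient_shift phi z x : differentiable phi (x - z) ->
  gradient (fun y => phi (y - z)) x = gradient phi (x - z).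
Proof.
move=> dphi; apply/rowP => k.
have e1 := gradientE k (differentiable_shift dphi).
apply: etrans e1 (etrans _ (esym (gradientE k dphi))).
rewrite /derive; set f := fun h : R => _; set g := fun h : R => _.
suff -> : f = g by [].
by apply/funext => h; rewrite /f /g /= addrA.
Qed.

End Calculus.

Section EpsilonDelta.
Context {R : realType} {V W : normedModType R}.

Lemma near_normP (x : V) (P : set V) :
  (\forall y \near x, P y) <->
  exists2 d : R, 0 < d & forall y, `|y - x| < d -> P y.
Proof.
split.
  move=> /nbhs_ballP[d /= d0 dP]; exists d => // y yd; apply: dP.
  by rewrite -ball_normE /= distrC.
move=> [d d0 dP]; apply/nbhs_ballP; exists d => // y.
by rewrite -ball_normE /= distrC; exact: dP.
Qed.

Lemma continuous_normP (f : V -> W) (x : V) :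
  {for x, continuous f} <->
  forall e : R, 0 < e ->
    exists2 d : R, 0 < d & forall y, `|y - x| < d -> `|f y - f x| < e.
Proof.
split=> [cf e e0|H].
  have [d d0 dP] := (near_normP x _).1 (cf _ (nbhsx_ballx (f x) e e0)).
  by exists d => // y /dP; rewrite /= -ball_normE /= distrC.
move=> A fA.
have [e /= e0 eA] := (nbhs_ballP (f x) A).1 fA.
have [d d0 dP] := H e e0.
apply/(near_normP x (f @^-1` A)); exists d => // y yd; apply: eA.
by rewrite -ball_normE /= distrC; exact: dP.
Qed.

End EpsilonDelta.

(** * Superdifferentials and test functions of class C1 *)

Section C1.
Context {R : realType} {N : nat}.
Implicit Types (f g phi psi : 'rV[R]_N -> R) (a x y z p : 'rV[R]_N).

Lemma C1_near_near phi x : C1_near phi x -> \forall y \near x, C1_near phi y.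
Proof. by move=> Cphi; apply: (near_join Cphi). Qed.

Lemma C1_near_differentiable phi x : C1_near phi x -> differentiable phi x.
Proof. by move=> /nbhs_singleton[]. Qed.

Lemma C1_near_gradient_continuous phi x :
  C1_near phi x -> {for x, continuous (gradient phi)}.
Proof. by move=> /nbhs_singleton[]. Qed.

Lemma C1_near_of_gradient phi (G : 'rV[R]_N -> 'rV[R]_N) x :
  (\forall y \near x, [/\ differentiable phi y, gradient phi y = G y &
     {for y, continuous G}]) ->
  C1_near phi x.
Proof.
move=> H; near=> y.
have [d _ cG] : [/\ differentiable phi y, gradient phi y = G y &
   {for y, continuous G}] by near: y.
split; first exact: d.
have /near_normP[r r0 Hr] : \forall t \near y, gradient phi t = G t.
  near: y; apply: filterS (near_join H) => y; apply: filterS => t; by case.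
apply/continuous_normP => e e0.
have [s s0 Hs] := (continuous_normP G y).1 cG e e0.
exists (Num.min r s) => [|t]; first by rewrite lt_min r0.
rewrite lt_min => /andP[tr ts].
by rewrite !Hr ?subrr ?normr0//; exact: Hs.
Unshelve. all: by end_near. Qed.

Lemma C1_near_cst c x : C1_near (cst c : 'rV[R]_N -> R) x.
Proof.
apply: (@C1_near_of_gradient _ (cst 0)); near=> y.
by split; [exact: differentiable_cst|exact: gradient_cst|exact: cst_continuous].
Unshelve. all: by end_near. Qed.

Lemma C1_near_sqdist a x : C1_near (sqdist a) x.
Proof.
apply: (@C1_near_of_gradient _ (fun y => 2 *: (y - a))); near=> y.
split; [exact: differentiable_sqdist|exact: gradient_sqdist|].
apply/continuous_normP => e e0; exists (e / 2); first exact: divr_gt0.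
move=> t ty; rewrite -scalerBr opprB addrA subrK normrZ ger0_norm//.
by rewrite mulrC -ltr_pdivlMr.
Unshelve. all: by end_near. Qed.

Lemma C1_nearD phi psi x :
  C1_near phi x -> C1_near psi x -> C1_near (phi + psi) x.
Proof.
move=> Cphi Cpsi.
apply: (@C1_near_of_gradient _ (fun y => gradient phi y + gradient psi y)).
apply: filterS2 Cphi Cpsi => y [dphi cphi] [dpsi cpsi].
split; [exact: differentiableD|exact: gradientD|exact: (continuousD cphi cpsi)].
Qed.

Lemma C1_nearZ c phi x : C1_near phi x -> C1_near (fun y => c * phi y) x.
Proof.
move=> Cphi.
apply: (@C1_near_of_gradient _ (fun y => c *: gradient phi y)).
apply: filterS Cphi => y [dphi cphi].
split; [exact: (@differentiableZ _ _ _ phi)|exact: gradientZ|exact: (continuousZl_tmp cphi)].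
Qed.

Lemma C1_near_shift phi z x :
  C1_near phi (x - z) -> C1_near (fun y => phi (y - z)) x.
Proof.
move=> Cphi.
have cs y : {for y, continuous (fun t : 'rV[R]_N => t - z)}.
  by apply/continuous_normP => e e0; exists e => // t; rewrite opprB addrA subrK.
apply: (@C1_near_of_gradient _ (fun y => gradient phi (y - z))).
have [r r0 Hr] := (near_normP (x - z) _).1 Cphi.
apply: (near_normP x _).2; exists r; first exact: r0.
move=> y yx.
have [|dphi cphi] := Hr (y - z); first by rewrite opprB addrA subrK.
split; last exact: (continuous_comp (cs y) cphi).
  exact: differentiable_shift.
exact: gradient_shift.
Qed.

(** On the line through [x] in each coordinate direction this is the rule of
    Fermat in one variable. *)
Lemma gradient_local_max phi x :
  C1_near phi x -> (\forall y \near x, phi y <= phi x) -> gradient phi x = 0.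
Proof.
move=> Cphi xmax; apply/rowP => k.
apply: etrans (gradientE k (C1_near_differentiable Cphi)) _.
rewrite [RHS]mxE; set v : 'rV[R]_N := delta_mx 0 k.
have [d d0 Hd] : exists2 d : R, 0 < d & forall y, `|y - x| < d ->
    differentiable phi y /\ phi y <= phi x.
  apply/near_normP; apply: filterS2 Cphi xmax => y [dphi _] phiy.
  by split; [exact: dphi|].
pose l (t : R) : 'rV[R]_N := t *: v + x.
have dl t : differentiable l t.
  apply: differentiableD; last exact: differentiable_cst.
  exact: (@differentiableZl _ _ _ id).
pose e := d / (`|v| + 1).
have v1 : 0 < `|v| + 1 by rewrite ltr_wpDl.
have e0 : 0 < e by rewrite divr_gt0.
have ld t : t \in `]- e, e[ -> `|l t - x| < d.
  rewrite in_itv /= -ltr_norml => te; rewrite /l addrK normrZ.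
  apply: (@le_lt_trans _ _ (`|t| * (`|v| + 1))).
    by rewrite ler_wpM2l ?normr_ge0// lerDl.
  by rewrite -ltr_pdivlMr.
have D0 : is_derive (0 : R) (1 : R) (phi \o l) 0.
  apply: (@derive1_at_max _ _ (- e) e).
  - by rewrite lerNl; lra.
  - move=> t /ld /Hd[dphi _]; apply/diff_derivable.
    exact: differentiable_comp.
  - by rewrite in_itv /= oppr_lt0 e0.
  - by move=> t /ld /Hd[_]; rewrite /= /l scale0r add0r.
rewrite -(@derive_val _ _ _ _ _ _ _ D0) /derive.
set f := fun h : R => _; set g := fun h : R => _.
suff -> : f = g by [].
by apply/funext => h; rewrite /f /g /= /l scale0r !add0r addr0 [h%:A]mulr1.
Qed.

(** The test function of [f] minus [psi] has a local minimum at [x], so that the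
    two gradients agree. *)
Lemma superdifferential_touching f psi x p :
  C1_near psi x -> psi x = f x -> (\forall y \near x, psi y <= f y) ->
  superdifferential f x p -> p = gradient psi x.
Proof.
move=> Cpsi psix psif [phi [Cphi fphi ->]].
have Cm : C1_near (psi + (fun y => -1 * phi y)) x.
  exact/C1_nearD/C1_nearZ.
have := gradient_local_max Cm; rewrite gradientD; last 2 first.
- exact: C1_near_differentiable.
- exact/C1_near_differentiable/C1_nearZ.
rewrite gradientZ; last exact: C1_near_differentiable.
rewrite scaleN1r => H; apply/eqP; rewrite -subr_eq0 -oppr_eq0 opprB.
apply/eqP/H; near=> y.
have h1 : psi y <= f y by near: y.
have h2 : f y - phi y <= f x - phi x by near: y.
change (psi y + -1 * phi y <= psi x + -1 * phi x); rewrite psix; lra.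
Unshelve. all: by end_near. Qed.

Lemma superdifferentialZ c f x p : 0 < c ->
  superdifferential (fun y => c * f y) x p ->
  superdifferential f x (c^-1 *: p).
Proof.
move=> c0 [phi [Cphi fphi ->]]; exists (fun y => c^-1 * phi y); split.
- exact: C1_nearZ.
- near=> y.
  have h : c * f y - phi y <= c * f x - phi x by near: y.
  rewrite -(ler_pM2l c0) !mulrBr !mulrA divff ?gt_eqF// !mul1r.
  exact: h.
- by rewrite gradientZ//; exact: C1_near_differentiable.
Unshelve. all: by end_near. Qed.

Lemma superdifferential_addC f c x p :
  superdifferential (fun y => f y + c) x p -> superdifferential f x p.
Proof.
move=> [phi [Cphi fphi ->]]; exists phi; split => //.
near=> y.
have : f y + c - phi y <= f x + c - phi x by near: y.
lra.
Unshelve. all: by end_near. Qed.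

Lemma superdifferential_le f g x p : f x = g x ->
  (\forall y \near x, g y <= f y) ->
  superdifferential f x p -> superdifferential g x p.
Proof.
move=> fg gf [phi [Cphi fphi ->]]; exists phi; split => //.
near=> y.
have h1 : f y - phi y <= f x - phi x by near: y.
have h2 : g y <= f y by near: y.
rewrite -fg; lra.
Unshelve. all: by end_near. Qed.

Lemma superdifferentialN f x p :
  superdifferential (fun y => - f y) x p -> subdifferential f x (- p).
Proof.
move=> [phi [Cphi fphi ->]]; exists (fun y => -1 * phi y); split.
- exact: C1_nearZ.
- near=> y.
  have : - f y - phi y <= - f x - phi x by near: y.
  lra.
- by rewrite gradientZ ?scaleN1r//; exact: C1_near_differentiable.
Unshelve. all: by end_near. Qed.

End C1.

(** * Compactness *)

Section Compactness.
Context {R : realType}.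

(** Compactness as an induction principle on subsets. If [P K] failed, the sets
    whose complement in [K] is covered by a set satisfying [P] would form a
    proper filter containing [K] and without cluster point in [K]. *)
Lemma compact_ideal (X : topologicalType) (K : set X) (P : set X -> Prop) :
  compact K -> P set0 ->
  (forall S T, S `<=` T -> P T -> P S) ->
  (forall S T, P S -> P T -> P (S `|` T)) ->
  (forall x, K x -> exists2 U, nbhs x U & P U) -> P K.
Proof.
move=> cK P0 Psub PU Ploc; apply: contrapT => nPK.
pose F : set_system X := [set S | exists2 T, P T & K `\` S `<=` T].
have FF : Filter F.
  constructor.
  - by exists set0 => // x [_]; apply.
  - move=> S T [S' PS' KS] [T' PT' KT]; exists (S' `|` T'); first exact: PU.
    move=> x [Kx] /not_andP[nS|nT]; [left; exact: KS|right; exact: KT].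
  - move=> S T ST [S' PS' KS]; exists S' => // x [Kx nT].
    by apply: KS; split => // /ST.
have PF : ProperFilter F.
  constructor; last exact: FF.
  move=> [T PT KT]; apply: nPK; by apply: Psub PT => x Kx; apply: KT; split.
have [|x [Kx clx]] := cK F PF; first by exists set0 => // x [].
have [U xU PU'] := Ploc x Kx.
have FU : F (~` U) by exists U => // x' [_] /contrapT.
by have [y [nUy Uy]] := clx _ _ FU xU.
Qed.

Context {N : nat}.
Notation V := 'rV[R]_N.

Lemma closed_ball_compact (x : V) (r : R) : compact [set y : V | `|y - x| <= r].
Proof.
apply: bounded_closed_compact.
  exists (`|x| + r); split; first exact: num_real.
  move=> M rM y /= yx; apply: le_trans (ltW rM).
  have -> : y = x + (y - x) by rewrite addrC subrK.
  by apply: le_trans (ler_normD _ _) _; rewrite lerD2l.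
have -> : [set y : V | `|y - x| <= r] = (fun y : V => `|y - x|) @^-1` [set t | t <= r].
  by [].
apply: closed_comp; last exact: closed_le.
move=> y _; apply/continuous_normP => e e0; exists e => // t ty.
apply: le_lt_trans ty; apply: le_trans (ler_dist_dist _ _) _.
by rewrite opprB addrA subrK.
Qed.

Lemma compact_max (X : topologicalType) (K : set X) (f : X -> R) :
  compact K -> K !=set0 -> (forall x, K x -> {for x, continuous f}) ->
  exists2 c, K c & forall x, K x -> f x <= f c.
Proof.
move=> cK K0 fK.
have [|c] := @compact_EVT_max X R f K K0 cK.
  by apply: continuous_in_subspaceT => x; rewrite inE; exact: fK.
by rewrite inE => Kc H; exists c => // x Kx; apply: H; rewrite inE.
Qed.

(** Heine's theorem, in the asymmetric form where only the first of the two
    points has to lie in [K]. *)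
Lemma uniform_continuity (K : set V) (g : V -> R) (e : R) :
  compact K -> continuous g -> 0 < e ->
  exists2 h : R, 0 < h & forall x z, K x -> `|z - x| < h -> `|g z - g x| < e.
Proof.
move=> cK cg e0.
pose P (S : set V) := exists2 h : R, 0 < h &
  forall x z, S x -> `|z - x| < h -> `|g z - g x| < e.
apply: (@compact_ideal V K P) => //.
- by exists 1.
- by move=> S T ST [h h0 H]; exists h => // x z /ST; exact: H.
- move=> S T [h h0 Hh] [l l0 Hl]; exists (Num.min h l); first by rewrite lt_min h0.
  by move=> x z; rewrite lt_min => -[Sx|Tx] /andP[zh zl]; [apply: Hh|apply: Hl].
- move=> x _.
  have [d d0 Hd] := (continuous_normP g x).1 (cg x) (e / 2) ltac:(lra).
  exists [set y | `|y - x| < d / 2].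
    by apply: (near_normP x _).2; exists (d / 2); first lra.
  exists (d / 2); first lra.
  move=> y z /= yx zy.
  have h1 : `|g y - g x| < e / 2 by apply: Hd; lra.
  have h2 : `|g z - g x| < e / 2.
    apply: Hd; rewrite -(subrK y z) -addrA; apply: le_lt_trans (ler_normD _ _) _; lra.
  rewrite -(subrK (g x) (g z)) -addrA; apply: le_lt_trans (ler_normD _ _) _.
  rewrite (distrC (g x)); lra.
Qed.

Lemma continuous_sqdist (a : V) : continuous (sqdist a).
Proof. move=> x; exact/differentiable_continuous/differentiable_sqdist. Qed.

Lemma sqdistC (a x : V) : sqdist a x = sqdist x a.
Proof. by apply: eq_bigr => k _; rewrite -sqrrN opprB. Qed.

Lemma sqdist_sub (a x : V) : sqdist a x = sqdist 0 (x - a).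
Proof. by apply: eq_bigr => k _; rewrite !mxE subr0. Qed.

Lemma C1_near_ball (phi : V -> R) (x : V) : C1_near phi x ->
  exists2 r : R, 0 < r & forall y, `|y - x| <= r -> C1_near phi y.
Proof.
move=> /C1_near_near Cphi.
have [r r0 Hr] := (near_normP x _).1 Cphi.
exists (r / 2); first by lra.
move=> y yx; apply: Hr; lra.
Qed.

Lemma sqdist_le_norm (a x : V) (c : R) : 0 <= c -> sqdist a x <= c ^+ 2 -> `|x - a| <= c.
Proof.
move=> c0 h; rewrite -(@ler_pXn2r _ 2)// ?nnegrE//.
exact: le_trans (sqr_norm_le_sqdist _ _) h.
Qed.

End Compactness.

(** * Doubling the variables *)

Section Fuzzy.
Context {R : realType} {N : nat}.
Notation V := 'rV[R]_N.
Implicit Types (f g phi : V -> R).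

Lemma sqdist_lt_norm (a x : V) (c : R) :
  0 < c -> sqdist a x < c ^+ 2 -> `|x - a| < c.
Proof.
move=> c0 h; rewrite ltNge; apply/negP => cx.
have c2 : c ^+ 2 <= `|x - a| ^+ 2 by rewrite lerXn2r// ?nnegrE// ltW.
have := lt_le_trans h (le_trans c2 (sqr_norm_le_sqdist a x)).
by rewrite ltxx.
Qed.

(** An approximate maximum point of [f - phi] lies near a true local maximum
    point of [f - phi - sqdist x0]. The tolerance [e] is chosen before [f]: this
    lets [f] be a member, taken afterwards, of the family whose supremum is
    tested by [phi]. *)
Lemma perturbed_max phi (x0 : V) (d r : R) : C1_near phi x0 -> 0 < d -> 0 < r ->
  exists2 e : R, 0 < e & forall f, continuous f ->
    (forall y, `|y - x0| <= r -> f y - phi y <= f x0 - phi x0 + e) ->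
    exists x p, [/\ `|x - x0| < d, superdifferential f x p &
      `|p - gradient phi x0| < d].
Proof.
move=> Cphi d0 r0.
have [s s0 Cs] := C1_near_ball Cphi.
have d2 : 0 < d / 2 by lra.
have [h h0 Hh] := (continuous_normP _ _).1 (C1_near_gradient_continuous Cphi) _ d2.
pose rho := Num.min (Num.min s r) (Num.min h (d / 4)).
have rho0 : 0 < rho by rewrite !lt_min s0 r0 h0 /=; lra.
have [rs rr rh rd] : [/\ rho <= s, rho <= r, rho <= h & rho <= d / 4].
  by split; rewrite /rho !ge_min lexx ?orbT.
exists ((rho / 2) ^+ 2); first by rewrite exprn_gt0//; lra.
move=> f cf Hf.
have [||y|x /= xK xmax] := @compact_max R V [set y : V | `|y - x0| <= rho]
    (fun y => f y - phi y - sqdist x0 y).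
- exact: closed_ball_compact.
- by exists x0; rewrite /= subrr normr0 ltW.
- move=> /= yK; apply: continuousB; last exact: continuous_sqdist.
  apply: continuousB; first exact: cf.
  apply/differentiable_continuous/C1_near_differentiable/Cs.
  exact: le_trans rs.
have xx0 : `|x - x0| <= rho / 2.
  apply: sqdist_le_norm; first lra.
  have := xmax x0; rewrite subrr normr0 sqdistxx => /(_ (ltW rho0)) h1.
  have := Hf x (le_trans xK rr); lra.
have Cx : C1_near (phi + sqdist x0) x.
  apply: C1_nearD; last exact: C1_near_sqdist.
  exact/Cs/(le_trans xK).
exists x, (gradient (phi + sqdist x0) x); split.
- lra.
- exists (phi + sqdist x0); split; [exact: Cx| |exact: erefl].
  apply: (near_normP x _).2; exists (rho / 2); first lra.
  move=> y yx.
  have yK : `|y - x0| <= rho.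
    rewrite -(subrK x y) -addrA; apply: le_trans (ler_normD _ _) _; lra.
  have := xmax y yK; rewrite -[(phi + sqdist x0) y]/(phi y + sqdist x0 y).
  rewrite -[(phi + sqdist x0) x]/(phi x + sqdist x0 x); lra.
- rewrite gradientD; last 2 first.
  + exact/C1_near_differentiable/Cs/(le_trans xK).
  + exact: differentiable_sqdist.
  rewrite gradient_sqdist addrAC; apply: le_lt_trans (ler_normD _ _) _.
  rewrite normrZ ger0_norm//.
  have := Hh x ltac:(lra); lra.
Qed.

(** Doubling of the variables. At a maximum point [(x, z)] of
    [f x + g z - phi x - sqdist x0 x - n * sqdist x z] on a small ball, a large
    [n] forces [x] and [z] together, then [sqdist x0 x] forces them near [x0];
    the gradients in [x] and in [z] of the last term are opposite, so that they
    cancel in [p + q].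

    The choice [g = - f] gives points of nonempty superdifferential, [g] the
    opposite of a supersolution gives the comparison at a contact point, and
    multiples of two subsolutions give the stability under convex
    combinations. *)
Lemma fuzzy_sum_rule f g phi (x0 : V) (d : R) :
  continuous f -> continuous g -> C1_near phi x0 -> 0 < d ->
  (\forall y \near x0, f y + g y - phi y <= f x0 + g x0 - phi x0) ->
  exists x z p q,
    [/\ `|x - x0| < d, `|z - x0| < d,
        superdifferential f x p, superdifferential g z q &
        `|p + q - gradient phi x0| < d].
Proof.
move=> cf cg Cphi d0 /near_normP[r r0 Hr].
have [s s0 Cs] := C1_near_ball Cphi.
have d2 : 0 < d / 2 by lra.
have [h h0 Hh] := (continuous_normP _ _).1 (C1_near_gradient_continuous Cphi) _ d2.
pose rho := Num.min (Num.min s (r / 2)) (Num.min h (d / 4)).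
have rho0 : 0 < rho by rewrite !lt_min s0 h0 /=; apply/andP; split; lra.
have [rs rr rh rd] : [/\ rho <= s, rho <= r / 2, rho <= h & rho <= d / 4].
  by split; rewrite /rho !ge_min lexx ?orbT.
pose K := [set y : V | `|y - x0| <= rho].
have cK : compact K by exact: closed_ball_compact.
have e0 : 0 < (rho / 2) ^+ 2 by rewrite exprn_gt0//; lra.
have [l l0 Hl] := uniform_continuity cK cg e0.
pose eta := Num.min l (rho / 4).
have eta0 : 0 < eta by rewrite lt_min l0 /=; lra.
have cphi y : K y -> {for y, continuous phi}.
  move=> yK; apply/differentiable_continuous/C1_near_differentiable/Cs.
  exact: le_trans rs.
pose T (w : V * V) := f w.1 + g w.2 - phi w.1.
have cKK := compact_setX cK cK.
have x0K : K x0 by rewrite /K /= subrr normr0 ltW.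
have KK0 : (K `*` K) !=set0 by exists (x0, x0).
have cT w : (K `*` K) w -> {for w, continuous T}.
  move=> [w1 w2]; have c1 : {for w, continuous (fst : V * V -> V)} by exact: cvg_fst.
  have c2 : {for w, continuous (snd : V * V -> V)} by exact: cvg_snd.
  apply: continuousB; last exact: (continuous_comp c1 (cphi _ w1)).
  apply: continuousD; first exact: (continuous_comp c1 (cf _)).
  exact: (continuous_comp c2 (cg _)).
have [[xm zm] mK Tmax] := compact_max cKK KK0 cT.
pose M := f x0 + g x0 - phi x0.
have cge0 : 0 <= T (xm, zm) - M.
  by rewrite subr_ge0; apply: (Tmax (x0, x0)).
(* At a maximum point the penalization is at most [T (xm, zm) - M]. *)
pose n := (T (xm, zm) - M + 1) / eta ^+ 2.
have n0 : 0 < n by rewrite divr_gt0 ?exprn_gt0//; lra.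
pose G (w : V * V) := T w - sqdist x0 w.1 - n * sqdist 0 (w.2 - w.1).
have cG w : (K `*` K) w -> {for w, continuous G}.
  move=> Kw; have c1 : {for w, continuous (fst : V * V -> V)} by exact: cvg_fst.
  have c2 : {for w, continuous (snd : V * V -> V)} by exact: cvg_snd.
  apply: continuousB; first apply: continuousB; first exact: cT.
    exact: (continuous_comp c1 (@continuous_sqdist _ _ _ _)).
  apply: (@continuousZl_tmp _ _ _ (fun w : V * V => sqdist 0 (w.2 - w.1)) n).
  exact: (continuous_comp (continuousB c2 c1) (@continuous_sqdist _ _ _ _)).
have [[x z] /= [xK zK] Gmax] := compact_max cKK KK0 cG.
have Gx0 : G (x0, x0) <= G (x, z) by exact: Gmax.
have GE a b : G (a, b) = f a + g b - phi a - sqdist x0 a - n * sqdist a b.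
  by rewrite /G /T /= -sqdist_sub.
rewrite !GE !sqdistxx mulr0 !subr0 -/M in Gx0.
have zx : `|z - x| < eta.
  have h1 : n * sqdist x z <= T (xm, zm) - M.
    have := Tmax (x, z) (conj xK zK); have := sqdist_ge0 x0 x; rewrite /T /=; lra.
  apply: sqdist_lt_norm => //.
  rewrite -(ltr_pM2l n0).
  have -> : n * eta ^+ 2 = T (xm, zm) - M + 1.
    by rewrite /n divfK// gt_eqF// exprn_gt0.
  lra.
have xK' : `|x - x0| <= rho by [].
have xx0 : `|x - x0| <= rho / 2.
  apply: sqdist_le_norm; first lra.
  have fgx : f x + g x - phi x <= M by apply: Hr; lra.
  have h2 : `|g z - g x| < (rho / 2) ^+ 2.
    by apply: Hl => //; apply: lt_le_trans zx _; rewrite ge_min lexx.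
  have h3 := mulr_ge0 (ltW n0) (sqdist_ge0 x z).
  have := ler_norm (g z - g x); lra.
have zx4 : `|z - x| < rho / 4 by apply: lt_le_trans zx _; rewrite ge_min lexx orbT.
have zx0 : `|z - x0| < 3 * rho / 4.
  rewrite -(subrK x z) -addrA; apply: le_lt_trans (ler_normD _ _) _; lra.
pose phix : V -> R := phi + sqdist x0 + (fun y => n * sqdist z y).
pose phiz : V -> R := fun y => n * sqdist x y.
have Cphi' : C1_near (phi + sqdist x0) x.
  apply: C1_nearD; last exact: C1_near_sqdist.
  exact/Cs/(le_trans xK).
have Cz : C1_near (fun y => n * sqdist z y) x by exact/C1_nearZ/C1_near_sqdist.
have near_K (a : V) : `|a - x0| < 3 * rho / 4 -> forall y, `|y - a| < rho / 4 -> K y.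
  move=> ax y ya; rewrite /K /= -(subrK a y) -addrA.
  by apply: le_trans (ler_normD _ _) _; lra.
exists x, z, (gradient phix x), (gradient phiz z); split.
- lra.
- lra.
- exists phix; split; [exact: (C1_nearD Cphi' Cz)| |exact: erefl].
  apply: (near_normP x _).2; exists (rho / 4); first lra.
  move=> y yx.
  have yK : K y by apply: (near_K x _ y yx); lra.
  have := Gmax (y, z) (conj yK zK); rewrite !GE (sqdistC y) (sqdistC x) /phix.
  rewrite -![(_ + sqdist x0 + _) _]/(phi _ + sqdist x0 _ + n * sqdist z _); lra.
- exists phiz; split; [exact/C1_nearZ/C1_near_sqdist| |exact: erefl].
  apply: (near_normP z _).2; exists (rho / 4); first lra.
  move=> y yz.
  have yK : K y by apply: (near_K z _ y yz); lra.
  have := Gmax (x, y) (conj xK yK); rewrite !GE /phiz; lra.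
- rewrite gradientD; last 2 first.
  + exact: C1_near_differentiable.
  + exact: C1_near_differentiable.
  rewrite gradientD; last 2 first.
  + exact/C1_near_differentiable/Cs/(le_trans xK).
  + exact: differentiable_sqdist.
  rewrite gradientZ; last exact: differentiable_sqdist.
  rewrite gradientZ; last exact: differentiable_sqdist.
  rewrite !gradient_sqdist -[X in X - _]addrA -scalerDr -scalerDr.
  rewrite -[x - z]opprB addNr !scaler0 addr0.
  rewrite addrAC; apply: le_lt_trans (ler_normD _ _) _.
  rewrite normrZ ger0_norm//.
  have := Hh x ltac:(lra); lra.
Qed.

End Fuzzy.

(** * A single Hamiltonian *)

Section Hamiltonian.
Context {R : realType} {N : nat}.
Notation V := 'rV[R]_N.
Implicit Types (f g phi F G : V -> R) (x y z p q : V).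

Lemma euclidean_normZ (c : R) p : euclidean_norm (c *: p) = `|c| * euclidean_norm p.
Proof.
rewrite /euclidean_norm -sqrtr_sqr -sqrtrM ?sqr_ge0//; congr Num.sqrt.
by rewrite mulr_sumr; apply: eq_bigr => k _; rewrite mxE exprMn.
Qed.

(** If the inequality fails for [x1] and [y], then the function
    [x |-> f x - (L + 1) * e x], where [e] is the distance to [y], has a maximum
    point [x] other than [y]. There [e] is replaced by the quadratic function
    [(e t ^+ 2 / e x + e x) / 2], which is above [e t] with equality at
    [t = x], and which leads to a momentum of norm [L + 1]. *)
Lemma bounded_superdifferential_lipschitz f (M L : R) :
  continuous f -> (forall x, f x <= M) -> 0 <= L ->
  (forall x p, superdifferential f x p -> euclidean_norm p <= L) ->
  forall x y, f x - f y <= (L + 1) * euclidean_norm (x - y).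
Proof.
move=> cf fM L0 fL x1 y; rewrite leNgt; apply/negP => H.
set e := fun x => euclidean_norm (x - y).
have e_ge0 x : 0 <= e x by exact: sqrtr_ge0.
have e2 x : e x ^+ 2 = sqdist y x by rewrite sqdistE.
(* Beyond the distance [rho] the penalization outweighs the bound [M], and
   the ball of radius [rho] contains [x1]. *)
pose rho := (M - f y + 1) / (L + 1) + `|x1 - y|.
have L1 : 0 < L + 1 by lra.
have My : f y <= M by exact: fM.
have rho0 : 0 < rho by rewrite ltr_pwDl// divr_gt0//; lra.
have cG x : {for x, continuous (fun x => f x - (L + 1) * e x)}.
  apply: continuousB; first exact: cf.
  apply: (@continuousZl_tmp _ _ _ e (L + 1)).
  have -> : e = Num.sqrt \o sqdist y.
    by apply/funext => t; rewrite /= -e2 sqrtr_sqr ger0_norm.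
  apply: continuous_comp; [exact: continuous_sqdist|exact: sqrt_continuous].
have cK : compact [set t : V | `|t - y| <= rho] by exact: closed_ball_compact.
have K0 : [set t : V | `|t - y| <= rho] !=set0.
  by exists y; rewrite /= subrr normr0 ltW.
have [x /= xK xmax] := compact_max cK K0 (fun t _ => cG t).
have x1K : `|x1 - y| <= rho by rewrite lerDr divr_ge0//; lra.
have Hx := xmax x1 x1K; rewrite -/(e x1) in H.
have out t : rho <= `|t - y| -> f t - (L + 1) * e t <= f y - 1.
  move=> ht; have h1 : rho <= e t by exact: le_trans (norm_le_euclidean_norm _).
  have h2 : (L + 1) * rho <= (L + 1) * e t by rewrite ler_pM2l.
  have h3 : M - f y + 1 <= (L + 1) * rho.
    by rewrite mulrDr mulrC divfK ?gt_eqF// lerDl mulr_ge0// ltW.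
  have := fM t; lra.
have xlt : `|x - y| < rho.
  rewrite ltNge; apply/negP => /out; lra.
have s0 : 0 < e x.
  rewrite lt_neqAle e_ge0 andbT eq_sym; apply/negP => /eqP ex0.
  have : sqdist y x = 0 by rewrite -e2 ex0 expr0n.
  move=> sx; have xy : x = y.
    apply/eqP; rewrite -subr_eq0 -normr_le0; apply: sqdist_le_norm => //.
    by rewrite sx expr0n.
  by move: Hx; rewrite ex0 xy; lra.
(* Up to a constant, the quadratic test function is [c * sqdist y]. *)
pose c := (L + 1) / (2 * e x).
have c0 : 0 < c by rewrite divr_gt0// mulr_gt0.
have Dx : superdifferential f x (gradient (fun t => c * sqdist y t) x).
  exists (fun t => c * sqdist y t); split; [exact/C1_nearZ/C1_near_sqdist| |exact: erefl].
  apply: (near_normP x _).2; exists (rho - `|x - y|); first by rewrite subr_gt0.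
  move=> t tx; have tK : `|t - y| <= rho.
    by rewrite -(subrK x t) -addrA; apply: le_trans (ler_normD _ _) _; lra.
  have := xmax t tK; rewrite -!e2.
  have : c * (e t ^+ 2) - c * e x ^+ 2 - (L + 1) * (e t - e x) = c * (e t - e x) ^+ 2.
    have -> : L + 1 = c * (2 * e x) by rewrite /c divfK// gt_eqF// mulr_gt0.
    ring.
  have := mulr_ge0 (ltW c0) (sqr_ge0 (e t - e x)); lra.
have := fL _ _ Dx; rewrite gradientZ; last exact: differentiable_sqdist.
rewrite gradient_sqdist scalerA euclidean_normZ ger0_norm; last by apply: mulr_ge0; lra.
rewrite -/(e x) /c.
have -> : (L + 1) / (2 * e x) * 2 * e x = L + 1.
  by field; rewrite gt_eqF.
lra.
Qed.

Lemma superdifferential_dense f x0 (d : R) : continuous f -> 0 < d ->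
  exists2 x, `|x - x0| < d & superdifferential f x !=set0.
Proof.
move=> cf d0.
have cg : continuous (fun y => - f y) by move=> y; apply: continuousN; exact: cf.
have [|x [z [p [q [xd _ Dp _ _]]]]] :=
    @fuzzy_sum_rule R N f (fun y => - f y) (cst 0) x0 d cf cg (C1_near_cst _ _) d0.
  by apply: (near_normP x0 _).2; exists 1 => // y _; rewrite !subrr.
by exists x => //; exists p.
Qed.

Variable h : V -> V -> R.
Hypothesis hH : convex_hamiltonian h.

Lemma hamiltonian_coercive (C : R) :
  exists2 A : R, 0 <= A & forall x p, h x p <= C -> euclidean_norm p <= A.
Proof.
have [_ _ _ [al [be [/cvgryPgt/(_ C) alC _ Hab]]]] := hH.
have [A [_ HA]] := alC.
exists `|A| => // x p hxp; rewrite leNgt; apply/negP => Ap.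
have := HA _ (le_lt_trans (ler_norm A) Ap).
have [] := Hab x p; rewrite ltNge => h1 _; apply/negP/negPn.
exact: le_trans h1 hxp.
Qed.

(** The joint continuity of [h] is uniform in [p] by compactness of the balls. *)
Lemma hamiltonian_uniform x0 (A e : R) : 0 < e ->
  exists2 d : R, 0 < d & forall x z p q, `|x - x0| < d -> `|z - x0| < d ->
    `|p| <= A -> `|q - p| < d -> `|h x p - h z q| < e.
Proof.
move=> e0.
pose K := [set p : V | `|p - 0| <= A].
pose P (S : set V) := exists2 d : R, 0 < d & forall x z p q,
  `|x - x0| < d -> `|z - x0| < d -> S p -> `|q - p| < d -> `|h x p - h z q| < e.
suff [d d0 Hd] : P K.
  exists d => // x z p q xd zd pA qd; apply: Hd => //.
  by rewrite /K /= subr0.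
apply: compact_ideal; first exact: closed_ball_compact.
- by exists 1.
- by move=> S T ST [d d0 Hd]; exists d => // x z p q xd zd /ST; exact: Hd.
- move=> S T [d d0 Hd] [l l0 Hl]; exists (Num.min d l); first by rewrite lt_min d0.
  move=> x z p q; rewrite !lt_min => /andP[x1 x2] /andP[z1 z2] [Sp|Tp] /andP[q1 q2].
    exact: Hd.
  exact: Hl.
- move=> p0 _.
  have [_ ch _ _] := hH.
  have [d d0 Hd] := (continuous_normP _ _).1 (ch (x0, p0)) (e / 2) ltac:(lra).
  exists [set p | `|p - p0| < d / 2].
    by apply: (near_normP p0 _).2; exists (d / 2); first lra.
  have Hd' x p : `|x - x0| < d -> `|p - p0| < d -> `|h x p - h x0 p0| < e / 2.
    by move=> xd pd; apply: (Hd (x, p)); rewrite prod_normE /= gt_max xd.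
  exists (d / 2); first lra.
  move=> x z p q xd zd /= pp qp.
  have h1 : `|h x p - h x0 p0| < e / 2 by apply: Hd'; lra.
  have h2 : `|h z q - h x0 p0| < e / 2.
    apply: Hd'; first lra.
    rewrite -(subrK p q) -addrA; apply: le_lt_trans (ler_normD _ _) _; lra.
  rewrite -(subrK (h x0 p0) (h x p)) -addrA; apply: le_lt_trans (ler_normD _ _) _.
  rewrite (distrC (h x0 p0)); lra.
Qed.

Lemma hamiltonian_convex x p q (t : R) : 0 <= t -> t <= 1 ->
  h x (t *: p + (1 - t) *: q) <= t * h x p + (1 - t) * h x q.
Proof.
move=> t0 t1; have [_ _ cv _] := hH.
have t01 : Itv.spec (@Itv.num_sem R) (Itv.Real `[0%Z, 1%Z]%O) t.
  by rewrite /= /Itv.num_sem /= num_real /= in_itv /= t0 t1.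
pose T : {i01 R} := Itv.mk t01.
by have := cv x T p q; rewrite !inE => /(_ I I).
Qed.

Lemma hamiltonian_bounded_below x0 :
  exists (C d : R), 0 < d /\ forall x p, `|x - x0| < d -> - C <= h x p.
Proof.
have [A A0 HA] := hamiltonian_coercive 0.
have [d d0 Hd] := hamiltonian_uniform x0 A ltr01.
have cK : compact [set p : V | `|p - 0| <= A] by exact: closed_ball_compact.
have K0 : [set p : V | `|p - 0| <= A] !=set0 by exists 0; rewrite /= subrr normr0.
have cG p : {for p, continuous (fun p => - h x0 p)}.
  apply: continuousN; apply/continuous_normP => e e0.
  have [d' d'0 Hd'] := hamiltonian_uniform x0 `|p| e0.
  exists d' => // q qp; rewrite distrC; apply: Hd' => //; rewrite subrr normr0//.
have [p0 _ p0max] := compact_max cK K0 (fun t _ => cG t).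
exists (`|h x0 p0| + 1), d; split=> // x p xd.
have [hp|/ltW hp] := leP (h x p) 0; last first.
  by apply: le_trans hp; rewrite oppr_le0 addr_ge0.
have pA : `|p| <= A by exact: le_trans (norm_le_euclidean_norm _) (HA x p hp).
have h1 : `|h x p - h x0 p| < 1.
  by apply: Hd => //; rewrite subrr normr0.
have h2 : - h x0 p <= - h x0 p0 by apply: p0max; rewrite /= subr0.
have h3 := ler_norm (- h x0 p0); rewrite normrN in h3.
move: h1; rewrite ltr_norml => /andP[h4 _].
lra.
Qed.

(** The fuzzy sum rule for [f] and [- g] gives a momentum [p] of [f] and a
    momentum of [g] that are almost equal, at two points near [x0]. Coercivity
    bounds [p], whence [h] takes almost the same values there. *)
Lemma touching_inequality f g F G x0 :
  continuous f -> continuous g ->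
  {for x0, continuous F} -> {for x0, continuous G} ->
  (\forall x \near x0, forall p, superdifferential f x p -> h x p <= F x) ->
  (\forall x \near x0, forall p, subdifferential g x p -> G x <= h x p) ->
  (\forall x \near x0, f x - g x <= f x0 - g x0) ->
  G x0 <= F x0.
Proof.
move=> cf cg cF cG fF gG fg; rewrite leNgt; apply/negP => FG.
pose e := (G x0 - F x0) / 4; have e0 : 0 < e by rewrite divr_gt0// subr_gt0.
have [A A0 HA] := hamiltonian_coercive (F x0 + e).
have [d1 d10 H1] := hamiltonian_uniform x0 A e0.
have [d2 d20 H2] := (continuous_normP _ _).1 cF e e0.
have [d3 d30 H3] := (continuous_normP _ _).1 cG e e0.
have [d4 d40 H4] := (near_normP _ _).1 fF.
have [d5 d50 H5] := (near_normP _ _).1 gG.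
pose d := Num.min (Num.min d1 d2) (Num.min d3 (Num.min d4 d5)).
have d0 : 0 < d by rewrite !lt_min d10 d20 d30 d40 d50.
have dle t : t < d -> [/\ t < d1, t < d2, t < d3, t < d4 & t < d5].
  by rewrite !lt_min => /andP[/andP[? ?] /andP[? /andP[? ?]]].
have cg' : continuous (fun y => - g y) by move=> y; apply: continuousN; exact: cg.
have [|x [z [p [q [xd zd Dp Dq]]]]] :=
    @fuzzy_sum_rule R N f (fun y => - g y) (cst 0) x0 d cf cg' (C1_near_cst _ _) d0.
  by apply: filterS fg => y; rewrite !subr0.
rewrite gradient_cst subr0 => pq.
have [x1 x2 _ x4 _] := dle _ xd; have [z1 _ z3 _ z5] := dle _ zd.
have [pq1 _ _ _ _] := dle _ pq.
have hp := H4 x x4 p Dp; have hq := H5 z z5 _ (superdifferentialN Dq).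
have Fx := H2 x x2; have Gz := H3 z z3.
move: Fx Gz; rewrite !ltr_norml => /andP[_ Fx] /andP[Gz _].
have pA : `|p| <= A.
  apply: le_trans (norm_le_euclidean_norm _) (HA x p _); lra.
have := H1 x z p (- q) x1 z1 pA.
rewrite -opprD normrN addrC => /(_ pq1); rewrite ltr_norml => /andP[hh _].
have : G x0 - F x0 = 4 * e by rewrite /e; field.
lra.
Qed.

(** The fuzzy sum rule writes the gradient of a test function as
    [t *: p' + (1 - t) *: q'] up to a small error, where [p'] and [q'] are
    momenta of [f] and [g] at points near [x0]; then [h] is convex in the
    momentum. *)
Lemma convex_combination_superdifferential f g F G x0 (t : R) :
  0 < t -> t < 1 ->
  continuous f -> continuous g ->
  {for x0, continuous F} -> {for x0, continuous G} ->
  (\forall x \near x0, forall p, superdifferential f x p -> h x p <= F x) ->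
  (\forall x \near x0, forall p, superdifferential g x p -> h x p <= G x) ->
  forall p, superdifferential (fun x => t * f x + (1 - t) * g x) x0 p ->
    h x0 p <= t * F x0 + (1 - t) * G x0.
Proof.
move=> t0 t1 cf cg cF cG fF gG _ [phi [Cphi phimax ->]].
apply/ler_addgt0Pr => e' e'0.
pose e := e' / 3; have e0 : 0 < e by rewrite divr_gt0.
have s0 : 0 < 1 - t by rewrite subr_gt0.
have [A A0 HA] := hamiltonian_coercive (F x0 + e).
have [A' A'0 HA'] := hamiltonian_coercive (G x0 + e).
set P := gradient phi x0.
have [d1 d10 H1] := hamiltonian_uniform x0 (Num.max `|P| (Num.max A A')) e0.
have [d2 d20 H2] := (continuous_normP _ _).1 cF e e0.
have [d3 d30 H3] := (continuous_normP _ _).1 cG e e0.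
have [d4 d40 H4] := (near_normP _ _).1 fF.
have [d5 d50 H5] := (near_normP _ _).1 gG.
pose d := Num.min (Num.min d1 d2) (Num.min d3 (Num.min d4 d5)).
have d0 : 0 < d by rewrite !lt_min d10 d20 d30 d40 d50.
have dle u : u < d -> [/\ u < d1, u < d2, u < d3, u < d4 & u < d5].
  by rewrite !lt_min => /andP[/andP[? ?] /andP[? /andP[? ?]]].
have ctf : continuous (fun y => t * f y).
  by move=> y; apply: (@continuousZl_tmp _ _ _ f t); exact: cf.
have ctg : continuous (fun y => (1 - t) * g y).
  by move=> y; apply: (@continuousZl_tmp _ _ _ g (1 - t)); exact: cg.
have [x [z [p [q [xd zd Dp Dq pq]]]]] := fuzzy_sum_rule ctf ctg Cphi d0 phimax.
have [x1 x2 _ x4 _] := dle _ xd; have [z1 _ z3 _ z5] := dle _ zd.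
have [pq1 _ _ _ _] := dle _ pq.
have hp := H4 x x4 _ (superdifferentialZ t0 Dp).
have hq := H5 z z5 _ (superdifferentialZ s0 Dq).
have Fx := H2 x x2; have Gz := H3 z z3.
set p' := t^-1 *: p in hp; set q' := (1 - t)^-1 *: q in hq.
have mix : t *: p' + (1 - t) *: q' = p + q.
  by rewrite !scalerA !divff ?gt_eqF// !scale1r.
have hmix := hamiltonian_convex x0 p' q' (ltW t0) (ltW t1).
rewrite mix in hmix.
move: Fx Gz; rewrite !ltr_norml => /andP[_ Fx] /andP[_ Gz].
have pA : `|p'| <= A.
  apply: le_trans (norm_le_euclidean_norm _) (HA x p' _); lra.
have qA : `|q'| <= A'.
  apply: le_trans (norm_le_euclidean_norm _) (HA' z q' _); lra.
have x00 : `|x0 - x0| < d1 by rewrite subrr normr0.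
have hP : `|h x0 P - h x0 (p + q)| < e.
  by apply: H1 => //; rewrite le_max lexx.
have hxp : `|h x p' - h x0 p'| < e.
  by apply: H1 => //; rewrite ?subrr ?normr0// !le_max pA orbT.
have hzq : `|h z q' - h x0 q'| < e.
  by apply: H1 => //; rewrite ?subrr ?normr0// !le_max qA !orbT.
move: hP hxp hzq; rewrite !ltr_norml => /andP[_ hP] /andP[hxp _] /andP[hzq _].
have h1 : t * h x0 p' <= t * (F x0 + 2 * e) by rewrite ler_pM2l//; lra.
have h2 : (1 - t) * h x0 q' <= (1 - t) * (G x0 + 2 * e) by rewrite ler_pM2l//; lra.
have e3 : e' = 3 * e by rewrite /e; field.
lra.
Qed.

End Hamiltonian.

(** * The coupling and the contact of sub- and supersolutions *)

Section Coupling.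
Context {R : realType} {N m : nat}.
Notation V := 'rV[R]_N.
Variables (H : 'I_m -> V -> V -> R) (B : V -> 'M[R]_m).
Hypothesis hH : forall i, convex_hamiltonian (H i).
Hypothesis hBcont : forall i j, continuous (fun x => B x i j).
Hypothesis hBdeg : forall x, degenerate_coupling_matrix (B x).
Hypothesis hBirr : forall x, irreducible_matrix (B x).
Implicit Types (u v w : 'I_m -> V -> R) (x y p : V).

(** The [i]-th inequality of the system at one point: strictness is going to be
    a local property, possibly of a single equation. *)
Definition sub_at u i (a : R) x : Prop :=
  forall p, superdifferential (u i) x p -> H i x p + coupling B u x i <= a.

Definition strict_at u i x : Prop :=
  exists2 d : R, 0 < d & \forall y \near x, sub_at u i (- d) y.

(** As the rows of [B x] sum to zero, any constant may be subtracted. *)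
Lemma coupling_diff u v x i (c : R) :
  coupling B u x i - coupling B v x i =
  \sum_(j < m) B x i j * (u j x - v j x - c).
Proof.
have [_ /(_ i) B0] := hBdeg x.
have -> : \sum_(j < m) B x i j * (u j x - v j x - c) =
    coupling B u x i - coupling B v x i - c * \sum_(j < m) B x i j.
  by rewrite mulr_sumr -!sumrB; apply: eq_bigr => j _; ring.
by rewrite B0 mulr0 subr0.
Qed.

Lemma coupling_addC u x i (c : R) :
  coupling B (fun j y => u j y + c) x i = coupling B u x i.
Proof.
apply/eqP; rewrite -subr_eq0 (coupling_diff _ _ _ _ c); apply/eqP.
by apply: big1 => j _; ring.
Qed.

Lemma coupling_comb u v x i (t : R) :
  coupling B (fun j y => t * u j y + (1 - t) * v j y) x i =
  t * coupling B u x i + (1 - t) * coupling B v x i.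
Proof.
by rewrite /coupling !mulr_sumr -big_split; apply: eq_bigr => j _ /=; ring.
Qed.

Lemma B_offdiag x i j : j != i -> B x i j <= 0.
Proof. by have [[+ _] _] := hBdeg x; apply. Qed.

(** In [coupling_diff] the diagonal term vanishes, and the other terms are
    products of two nonpositive factors. *)
Lemma coupling_ge u v x i (c : R) :
  (forall j, u j x - v j x <= c) -> u i x - v i x = c ->
  0 <= coupling B u x i - coupling B v x i /\
  (coupling B u x i - coupling B v x i <= 0 ->
   forall j, B x i j != 0 -> u j x - v j x = c).
Proof.
move=> uv uvi; rewrite (coupling_diff _ _ _ _ c).
have pos j : 0 <= B x i j * (u j x - v j x - c).
  have [->|ji] := eqVneq j i; first by rewrite uvi subrr mulr0.
  by rewrite mulr_le0// ?B_offdiag// subr_le0.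
split=> [|s0 j Bij]; first exact: sumr_ge0.
have s00 : \sum_(j < m) B x i j * (u j x - v j x - c) = 0.
  by apply/eqP; rewrite eq_le s0 sumr_ge0.
have /(_ isT)/eqP := psumr_eq0P (fun j _ => pos j) s00 (i := j).
by rewrite mulf_eq0 (negbTE Bij) subr_eq0 => /eqP.
Qed.

Lemma coupling_continuous u i : (forall j, continuous (u j)) ->
  continuous (fun x => coupling B u x i).
Proof.
move=> cu x; rewrite /coupling.
have -> : (fun x : V => \sum_(j < m) B x i j * u j x) =
   \sum_(j < m) ((fun x => B x i j) * u j).
  by apply/funext => y; rewrite fct_sumE.
elim/big_ind : _ => [|f g cf cg|j _].
- exact: cst_continuous.
- exact: continuousD.
- by apply: continuousM; [exact: hBcont|exact: cu].
Qed.

Lemma subsolutions_addC u (a c : R) : subsolutions H B a u ->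
  subsolutions H B a (fun i x => u i x + c).
Proof.
move=> [cu su]; split=> [i|x i p Dp].
  have [cui tui] := cu i; split=> [x|k x]; last by rewrite tui.
  by apply: continuousD; [exact: cui|exact: cst_continuous].
by rewrite coupling_addC; apply/su/superdifferential_addC/Dp.
Qed.

Lemma sub_at_comb u v i (a b t : R) x :
  (forall j, continuous (u j)) -> (forall j, continuous (v j)) ->
  0 < t -> t < 1 ->
  (\forall y \near x, sub_at u i a y) -> (\forall y \near x, sub_at v i b y) ->
  sub_at (fun j y => t * u j y + (1 - t) * v j y) i (t * a + (1 - t) * b) x.
Proof.
move=> cu cv t0 t1 su sv p Dp.
have cc (w : 'I_m -> V -> R) (c : R) : (forall j, continuous (w j)) ->
    {for x, continuous (fun y => c - coupling B w y i)}.
  move=> cw; apply: continuousB; first exact: cst_continuous.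
  exact: coupling_continuous.
have near_sub (w : 'I_m -> V -> R) (c : R) : (\forall y \near x, sub_at w i c y) ->
    \forall y \near x, forall q, superdifferential (w i) y q ->
      H i y q <= c - coupling B w y i.
  move=> /near_normP[d d0 Hd]; apply: (near_normP x _).2; exists d; first exact: d0.
  by move=> y yd q Dq; have := Hd y yd q Dq; lra.
have := convex_combination_superdifferential (hH i) t0 t1 (cu i) (cv i)
  (cc u a cu) (cc v b cv) (near_sub u a su) (near_sub v b sv) Dp.
rewrite coupling_comb; lra.
Qed.

Lemma near_near_sub_at u i (a : R) x :
  (\forall y \near x, sub_at u i a y) ->
  \forall z \near x, \forall y \near z, sub_at u i a y.
Proof. by move=> su; apply: (near_join su). Qed.

Lemma strict_at_comb u v i (t : R) x :
  (forall j, continuous (u j)) -> (forall j, continuous (v j)) ->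
  0 < t -> t < 1 ->
  (\forall y \near x, sub_at u i 0 y) -> strict_at v i x ->
  strict_at (fun j y => t * u j y + (1 - t) * v j y) i x.
Proof.
move=> cu cv t0 t1 /near_near_sub_at/near_normP[d d0 su].
move=> [e e0 /near_near_sub_at/near_normP[l l0 sv]].
exists ((1 - t) * e); first by rewrite mulr_gt0// subr_gt0.
apply: (near_normP x _).2; exists (Num.min d l); first by rewrite lt_min d0.
move=> y; rewrite lt_min => /andP[yd yl].
have := sub_at_comb cu cv t0 t1 (su y yd) (sv y yl).
by rewrite mulr0 add0r mulrN.
Qed.

Lemma subsolutions_comb u v (t : R) : 0 < t -> t < 1 ->
  subsolutions H B 0 u -> subsolutions H B 0 v ->
  subsolutions H B 0 (fun j y => t * u j y + (1 - t) * v j y).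
Proof.
move=> t0 t1 [cu su] [cv sv]; split=> [i|x i].
  have [cui tui] := cu i; have [cvi tvi] := cv i.
  split=> [x|k x]; last by rewrite tui tvi.
  have c1 : {for x, continuous (fun x => t * u i x)}.
    by apply: (@continuousZl_tmp _ _ _ (u i) t); exact: cui.
  have c2 : {for x, continuous (fun x => (1 - t) * v i x)}.
    by apply: (@continuousZl_tmp _ _ _ (v i) (1 - t)); exact: cvi.
  exact: (continuousD c1 c2).
have := @sub_at_comb u v i 0 0 t x (fun j => (cu j).1) (fun j => (cv j).1) t0 t1.
rewrite !mulr0 addr0; apply; apply: (near_normP x _).2; exists 1 => // y _ p.
- exact: su.
- exact: sv.
Qed.

(** At an index [i] in contact, [touching_inequality] gives
    [coupling B u x i - coupling B v x i <= 0], and even a negative upper bound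
    if [u] is strict there; by [coupling_ge] this difference is nonnegative, and
    if it vanishes then the contact extends to all [j] with [B x i j != 0].
    Irreducibility reaches all indices. *)
Lemma contact_propagation u v (M : R) x k :
  subsolutions H B 0 u -> supersolutions H B 0 v ->
  (\forall y \near x, forall i, u i y - v i y <= M) -> u k x - v k x = M ->
  forall i, u i x - v i x = M /\ ~ strict_at u i x.
Proof.
move=> [cu su] [cv sv] uvM uvk.
have uvx j : u j x - v j x <= M by have := nbhs_singleton uvM; apply.
have contact i (a : R) : u i x - v i x = M -> (\forall y \near x, sub_at u i a y) ->
    coupling B u x i - coupling B v x i <= a.
  move=> uvi sua.
  have cuc : {for x, continuous (fun y => a - coupling B u y i)}.
    apply: continuousB; first exact: cst_continuous.
    by apply: coupling_continuous => j; exact: (cu j).1.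
  have cvc : {for x, continuous (fun y => - coupling B v y i)}.
    by apply: continuousN; apply: coupling_continuous => j; exact: (cv j).1.
  have := @touching_inequality R N _ (hH i) (u i) (v i) _ _ x (cu i).1 (cv i).1 cuc cvc.
  have h1 : \forall y \near x, forall p, superdifferential (u i) y p ->
      H i y p <= a - coupling B u y i.
    have [d d0 Hd] := (near_normP x _).1 sua.
    apply: (near_normP x _).2; exists d; first exact: d0.
    by move=> y yd q Dq; have := Hd y yd q Dq; lra.
  have h2 : \forall y \near x, forall p, subdifferential (v i) y p ->
      - coupling B v y i <= H i y p.
    apply: (near_normP x _).2; exists 1 => // y _ q Dq.
    by have := sv y i q Dq; lra.
  have h3 : \forall y \near x, u i y - v i y <= u i x - v i x.
    by apply: filterS uvM => y; rewrite uvi; apply.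
  move=> /(_ h1 h2 h3); lra.
have su0 i : \forall y \near x, sub_at u i 0 y.
  by apply: (near_normP x _).2; exists 1 => // y _ q; exact: su.
have all_eq i : u i x - v i x = M.
  apply/eqP; apply/negPn/negP => uvi.
  pose J := [set j : 'I_m | u j x - v j x == M]%SET.
  have J0 : J != finset.set0.
    by apply/set0Pn; exists k; rewrite inE uvk.
  have JT : J \proper finset.setT.
    rewrite finset.properT; apply/negP => /eqP JT; move/negP: uvi; apply.
    have : i \in J by rewrite JT finset.in_setT.
    by rewrite inE.
  have [i' [j [i'J jJ Bij]]] := hBirr x J0 JT.
  move: i'J jJ; rewrite !inE => /eqP ei' /negP; apply; apply/eqP.
  have [_ C2] := coupling_ge uvx ei'.
  by apply: C2 => //; exact: contact.
move=> i; split; first exact: all_eq.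
move=> [d d0 sd]; have [C1 _] := coupling_ge uvx (all_eq i).
have := contact i _ (all_eq i) sd; lra.
Qed.

End Coupling.

(** * Periodicity *)

Section Lattice.
Context {R : realType} {N : nat}.
Notation V := 'rV[R]_N.
Implicit Types (x y z : V).

Definition lattice z : Prop := forall k, z 0 k \is a Num.int.

Lemma torus_fun_lattice (W : zmodType) (f : V -> W) x z :
  torus_fun f -> lattice z -> f (x + z) = f x.
Proof.
move=> tf lz; rewrite (row_sum_delta z).
have step (n : int) (k : 'I_N) (y : V) : f (y + n%:~R *: delta_mx 0 k) = f y.
  elim/int_ind: n y => [|n IH|n IH] y; first by rewrite scale0r addr0.
    have -> : y + n.+1%:~R *: delta_mx 0 k = y + n%:~R *: delta_mx 0 k + delta_mx 0 k.
      by rewrite -!pmulrn -natr1 -!addrA scalerDl scale1r.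
    by rewrite tf IH.
  rewrite -(tf k) -[in RHS]IH.
  have -> // : y + (- n.+1%:Z)%:~R *: delta_mx 0 k + delta_mx 0 k =
      y + (- n%:Z)%:~R *: delta_mx 0 k.
  by rewrite !mulrNz -!pmulrn -natr1 opprD scalerDl scaleN1r addrA subrK.
elim/big_ind: _ x => [x|a b IHa IHb x|k _ x]; first by rewrite addr0.
  by rewrite addrA IHb IHa.
by have /intrP[n ->] := lz k.
Qed.

Lemma latticeN z : lattice z -> lattice (- z).
Proof. by move=> lz k; rewrite mxE rpredN. Qed.

Lemma torus_fun_latticeB (W : zmodType) (f : V -> W) x z :
  torus_fun f -> lattice z -> f (x - z) = f x.
Proof. by move=> tf /latticeN; exact: torus_fun_lattice. Qed.

(** [x - round y x] is the representative of [x] modulo the lattice in the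
    half-open unit cube centred at [y]. *)
Definition round y x : V := \row_k (Num.floor (x 0 k - y 0 k + 2^-1))%:~R.

Lemma lattice_round y x : lattice (round y x).
Proof. by move=> k; rewrite mxE intr_int. Qed.

Lemma round_lattice y x z : lattice z -> round y (x + z) = round y x + z.
Proof.
move=> lz; apply/rowP => k; rewrite !mxE.
have -> : x 0 k + z 0 k - y 0 k + 2^-1 = x 0 k - y 0 k + 2^-1 + z 0 k by ring.
by rewrite (floorDrz _ (lz k)) rmorphD /= (floorK (lz k)).
Qed.

Lemma round_itv y x k :
  - 2^-1 <= x 0 k - round y x 0 k - y 0 k /\ x 0 k - round y x 0 k - y 0 k < 2^-1.
Proof.
rewrite mxE; have /andP[] := floor_itv (x 0 k - y 0 k + 2^-1).
rewrite rmorphD /=; lra.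
Qed.

Lemma round_norm y x : `|x - round y x - y| <= 2^-1.
Proof.
apply: norm_le_coord => // k; rewrite ler_norml.
have [h1 h2] := round_itv y x k.
have -> : (x - round y x - y) 0 k = x 0 k - round y x 0 k - y 0 k by rewrite !mxE.
by rewrite h1 ltW.
Qed.

Lemma round_near y x : `|x - y| < 2^-1 -> round y x = 0.
Proof.
move=> xy; apply/rowP => k; rewrite !mxE.
have := le_lt_trans (coord_le_norm (x - y) k) xy.
have -> : (x - y) 0 k = x 0 k - y 0 k by rewrite !mxE.
rewrite ltr_norml => /andP[h1 h2].
suff -> : Num.floor (x 0 k - y 0 k + 2^-1) = 0 by [].
by apply: floor_def; rewrite add0r mulr0z mulr1z; apply/andP; split; lra.
Qed.

(** A translate of [x] at distance less than [1 / 2] from [y] is the one that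
    [round] selects; otherwise [round_norm] suffices. *)
Lemma round_min y x z : lattice z -> `|x - round y x - y| <= `|x - z - y|.
Proof.
move=> lz; have := round_norm y x; set a := `|x - z - y| => H.
have [ha|ha] := ltP a 2^-1; last exact: le_trans ha.
have := round_near (x := x - z) ha.
by rewrite round_lattice; [move=> /subr0_eq ->|exact: latticeN].
Qed.

(** The rounding jumps only where [x - round y x] is on the boundary of the
    cube. By [round_min] all translates of the points near such a point are at
    distance at least [1 / 4] from [y], where [g] vanishes. *)
Lemma periodize_continuous (g : V -> R) y (r : R) : r <= 4^-1 ->
  continuous g -> (forall x, r <= `|x - y| -> g x = 0) ->
  continuous (fun x => g (x - round y x)).
Proof.
move=> r4 cg g0 x0; apply/continuous_normP => e e0.
have [ha|ha] := ltP `|x0 - round y x0 - y| 2^-1.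
  have [d d0 Hd] := (continuous_normP _ _).1 (cg (x0 - round y x0)) e e0.
  exists (Num.min d (2^-1 - `|x0 - round y x0 - y|)).
    by rewrite lt_min d0 subr_gt0.
  move=> x; rewrite lt_min => /andP[xd xr].
  have -> : round y x = round y x0.
    apply/subr0_eq; rewrite -round_lattice; last exact/latticeN/lattice_round.
    apply: round_near.
    have -> : x - round y x0 - y = (x - x0) + (x0 - round y x0 - y).
      by rewrite !addrA subrK.
    by apply: le_lt_trans (ler_normD _ _) _; lra.
  by apply: Hd; rewrite opprB addrA subrK.
exists 4^-1 => // x xx0.
have far (t : V) : 4^-1 <= `|t - round y t - y| -> g (t - round y t) = 0.
  by move=> h; apply: g0; exact: le_trans h.
rewrite !far ?subrr ?normr0//; first lra.
have := round_min y x0 (lattice_round y x).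
have -> : x0 - round y x - y = (x0 - x) + (x - round y x - y).
  by rewrite !addrA subrK.
by have := ler_normD (x0 - x) (x - round y x - y); rewrite (distrC x0); lra.
Qed.

End Lattice.

(** * Differences bounded through an irreducible matrix *)

Section Matrix.
Context {R : realType} {m : nat}.

(** Let [t i0] be the largest entry of [t], and let [I] be a proper subset of
    indices where [t] is known to be close to [t i0]. Irreducibility gives [i]
    in [I] and [j] outside [I] with [b i j] bounded away from zero. In the
    [i]-th inequality the terms other than the [j]-th are bounded below, so that
    [t i - t j] is bounded and [j] may be added to [I]. The constants depend
    only on [b0], [th], [be] and [C0]: in the application [b] is the matrix at
    any point near a given one. *)
Lemma irreducible_differences_bounded (b0 : 'M[R]_m) (th be C0 : R) :
  irreducible_matrix b0 -> 0 < th -> 0 <= be -> 0 <= C0 ->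
  exists C : R, 0 <= C /\ forall (b : 'M[R]_m) (t : 'I_m -> R),
    degenerate_coupling_matrix b ->
    (forall i j, b0 i j != 0 -> th <= `|b i j|) ->
    (forall i j, `|b i j| <= be) ->
    (forall i, \sum_(j < m) b i j * t j <= C0) ->
    forall i j, t i - t j <= C.
Proof.
move=> irr th0 be0 C00.
have claim (n : nat) : (n < m)%N -> exists C : R, 0 <= C /\
    forall (b : 'M[R]_m) (t : 'I_m -> R),
    degenerate_coupling_matrix b ->
    (forall i j, b0 i j != 0 -> th <= `|b i j|) ->
    (forall i j, `|b i j| <= be) ->
    (forall i, \sum_(j < m) b i j * t j <= C0) ->
    forall i0, (forall j, t j <= t i0) ->
    exists I : {set 'I_m}, (n < #|I|)%N /\ forall i, i \in I -> t i0 - t i <= C.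
  elim: n => [_|n IH nm].
    exists 0; split => // b t _ _ _ _ i0 _; exists [set i0]%SET.
    by rewrite cards1; split => // i; rewrite inE => /eqP ->; rewrite subrr.
  have [C [C0' HC]] := IH (ltnW nm).
  pose D := (C0 + m%:R * (be * C)) / th.
  have D0 : 0 <= D by apply: divr_ge0; [rewrite addr_ge0// !mulr_ge0|exact: ltW].
  exists (C + D); split; first exact: addr_ge0.
  move=> b t deg bth bbe bC i0 i0max.
  have [I [nI HI]] := HC b t deg bth bbe bC i0 i0max.
  have [nI'|nI'] := ltnP n.+1 #|I|.
    by exists I; split=> // i iI; apply: le_trans (HI i iI) _; rewrite lerDl.
  have I0 : I != finset.set0 by rewrite -card_gt0; exact: leq_ltn_trans nI.
  have IT : I \proper finset.setT.
    rewrite finset.properT; apply: contraTneq nI' => ->.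
    by rewrite cardsT card_ord -ltnNge.
  have [i [j [iI jI bij]]] := irr I I0 IT.
  exists (j |: I)%SET; split.
    by rewrite cardsU1 jI add1n ltnS.
  move=> l; rewrite !inE => /orP[/eqP ->|lI]; last first.
    by apply: le_trans (HI l lI) _; rewrite lerDl.
  have ji : j != i by apply: contraNneq jI => ->.
  have [[bneg _] bsum] := deg.
  have ti := HI i iI.
  have E : \sum_(l < m) b i l * t l = \sum_(l < m) b i l * (t l - t i).
    have -> : \sum_(l < m) b i l * (t l - t i) =
        \sum_(l < m) b i l * t l - (\sum_(l < m) b i l) * t i.
      by rewrite mulr_suml -sumrB; apply: eq_bigr => l' _; ring.
    by rewrite bsum mul0r subr0.
  have term (l' : 'I_m) : - (be * C) <= b i l' * (t l' - t i).
    have [->|l'i] := eqVneq l' i.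
      by rewrite subrr mulr0 oppr_le0 mulr_ge0.
    have h1 : t l' - t i <= C by have := i0max l'; lra.
    have h2 := bneg i l' l'i; have := bbe i l'; rewrite ler0_norm// => h3.
    have h4 : b i l' * C <= b i l' * (t l' - t i) by rewrite ler_wnM2l.
    have h5 : - b i l' * C <= be * C by rewrite ler_wpM2r.
    lra.
  have rest : - (m%:R * (be * C)) <= \sum_(l < m | l != j) b i l * (t l - t i).
    apply: (@le_trans _ _ (\sum_(l < m | l != j) - (be * C))); last first.
      by apply: ler_sum => l' _; exact: term.
    rewrite sumrN lerN2 big_mkcond /=.
    apply: (@le_trans _ _ (\sum_(l < m) (be * C))).
      by apply: ler_sum => l' _; case: ifP => // _; rewrite mulr_ge0.
    by rewrite sumr_const card_ord mulr_natl.
  have := bC i; rewrite E (bigD1 j)//= => tot.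
  have key : - b i j * (t i - t j) <= C0 + m%:R * (be * C) by lra.
  have thb : th <= - b i j by have := bth i j bij; rewrite ler0_norm// bneg.
  have tij : t i - t j <= D.
    rewrite /D ler_pdivlMr// mulrC.
    have [tp|tn] := leP 0 (t i - t j).
      by apply: le_trans key; rewrite ler_wpM2r.
    apply: (@le_trans _ _ 0); first by rewrite mulr_ge0_le0// ltW.
    by rewrite addr_ge0// !mulr_ge0.
  lra.
have [m0|m0] := posnP m.
  exists 0; split => // b t _ _ _ _ i.
  by have := ltn_ord i; rewrite [X in (_ < X)%N]m0.
have [C [C0' HC]] := claim m.-1 ltac:(by rewrite prednK).
exists C; split=> // b t deg bth bbe bC i j.
have [i0 _ i0max] := @arg_maxP _ R _ i xpredT t isT.
have [l|I [mI HI]] := HC b t deg bth bbe bC i0; first exact: i0max.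
have jI : j \in I.
  have /eqP -> : I == finset.setT; last by rewrite finset.in_setT.
  by rewrite eqEcard finset.subsetT cardsT card_ord; move: mI; rewrite prednK.
have ti0 : t i <= t i0 by exact: i0max.
have := HI j jI; lra.
Qed.

End Matrix.

(** * Uniform estimates on critical subsolutions *)

Section Estimates.
Context {R : realType} {N m : nat}.
Notation V := 'rV[R]_N.
Variables (H : 'I_m -> V -> V -> R) (B : V -> 'M[R]_m).
Hypothesis hH : forall i, convex_hamiltonian (H i).
Hypothesis hBtorus : torus_fun B.
Hypothesis hBcont : forall i j, continuous (fun x => B x i j).
Hypothesis hBdeg : forall x, degenerate_coupling_matrix (B x).
Hypothesis hBirr : forall x, irreducible_matrix (B x).
Implicit Types (u v w : 'I_m -> V -> R) (x y z p : V).

Lemma near_forall_index (T : finType) (P : T -> V -> Prop) x :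
  (forall i, \forall y \near x, P i y) -> \forall y \near x, forall i, P i y.
Proof. by move=> h; apply: filter_forall h. Qed.

Lemma common_bound (T : finType) (P : T -> R -> Prop) :
  (forall i c c', c <= c' -> P i c -> P i c') ->
  (forall i, exists c, P i c) -> exists2 c, 0 <= c & forall i, P i c.
Proof.
move=> Pmono /choice[c Pc]; exists (\sum_i `|c i|); first exact: sumr_ge0.
move=> i; apply: Pmono (Pc i); apply: le_trans (ler_norm _) _.
by rewrite (bigD1 i)//= lerDl sumr_ge0.
Qed.

Lemma coupling_lattice w x z i : continuous_torus_tuple w -> lattice z ->
  coupling B w (x + z) i = coupling B w x i.
Proof.
move=> cw lz; apply: eq_bigr => j _.
by rewrite (torus_fun_lattice x hBtorus lz) (torus_fun_lattice x (cw j).2 lz).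
Qed.

(** Periodic quantities are controlled by their values on the cube of centre [0],
    which is compact. *)
Lemma cube_representative x : exists2 z, lattice z & `|x - z| <= 2^-1.
Proof.
exists (round 0 x); first exact: lattice_round.
by have := round_norm 0 x; rewrite subr0.
Qed.

(** Where [w i] has a momentum, the [i]-th inequality and a lower bound on the
    Hamiltonian bound the coupling; such points are dense. *)
Lemma coupling_bounded_above x0 : exists2 C : R, 0 <= C &
  \forall x \near x0, forall i w, subsolutions H B 0 w -> coupling B w x i <= C.
Proof.
have [C C0 HC] : exists2 C : R, 0 <= C &
    forall i, \forall x \near x0, forall p, - C <= H i x p.
  apply: common_bound => [i c c' cc'|i].
    by apply: filterS => x h p; apply: le_trans (h p); rewrite lerN2.
  have [C [d [d0 Hd]]] := hamiltonian_bounded_below (hH i) x0.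
  exists C; apply: (near_normP x0 _).2; exists d => // x xd p; exact: Hd.
exists C => //.
have := near_forall_index HC => /near_normP[d d0 Hd].
apply: (near_normP x0 _).2; exists d => // x xd i w [cw sw].
rewrite leNgt; apply/negP => wC.
have cc : {for x, continuous (fun y => coupling B w y i)}.
  by apply: (coupling_continuous hBcont) => j; exact: (cw j).1.
have e0 : 0 < coupling B w x i - C by rewrite subr_gt0.
have [l l0 Hl] := (continuous_normP _ _).1 cc _ e0.
have r0 : 0 < Num.min l (d - `|x - x0|) by rewrite lt_min l0 subr_gt0.
have [y] := superdifferential_dense x (cw i).1 r0.
rewrite lt_min => /andP[yl yd] [p Dp].
have h1 : - C <= H i y p.
  apply: Hd; rewrite -(subrK x y) -addrA; apply: le_lt_trans (ler_normD _ _) _; lra.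
have := Hl y yl; rewrite ltr_norml => /andP[h2 _].
have := sw y i p Dp; lra.
Qed.

Lemma coupling_centered w x i :
  coupling B w x i = \sum_(j < m) B x i j * (w j x - w i x).
Proof.
have [_ /(_ i) B0] := hBdeg x.
have -> : \sum_(j < m) B x i j * (w j x - w i x) =
    coupling B w x i - (\sum_(j < m) B x i j) * w i x.
  by rewrite mulr_suml -sumrB; apply: eq_bigr => j _; ring.
by rewrite B0 mul0r subr0.
Qed.

Lemma local_estimate x0 : exists2 C : R, 0 <= C & \forall x \near x0,
  forall w, subsolutions H B 0 w ->
  (forall i j, w i x - w j x <= C) /\ (forall i, - C <= coupling B w x i).
Proof.
have [C0 C00 HC0] := coupling_bounded_above x0.
(* Near [x0] the entries that do not vanish at [x0] stay above [th] in absolute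
   value, and all the entries below [be]. *)
pose th : R := \big[Num.min/1]_(ij : 'I_m * 'I_m | B x0 ij.1 ij.2 != 0)
   (`|B x0 ij.1 ij.2| / 2).
have th0 : 0 < th.
  rewrite /th; elim/big_ind : _ => // [a b a0 b0|ij Bij]; first by rewrite lt_min a0.
  by rewrite divr_gt0// normr_gt0.
have th_le i j : B x0 i j != 0 -> th <= `|B x0 i j| / 2.
  by move=> Bij; rewrite /th (bigD1 (i, j))//= ge_min lexx.
pose be : R := \sum_(ij : 'I_m * 'I_m) (`|B x0 ij.1 ij.2| + 1).
have be_ge i j : `|B x0 i j| + 1 <= be.
  by rewrite /be (bigD1 (i, j))//= lerDl sumr_ge0// => ij _; rewrite addr_ge0.
have be0 : 0 <= be by apply: sumr_ge0 => ij _; rewrite addr_ge0.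
have [C1 [C10 HC1]] := irreducible_differences_bounded (@hBirr x0) th0 be0 C00.
have Bnear : \forall x \near x0, forall ij : 'I_m * 'I_m,
    (B x0 ij.1 ij.2 != 0 -> th <= `|B x ij.1 ij.2|) /\ `|B x ij.1 ij.2| <= be.
  apply: near_forall_index => -[i j] /=.
  have [d d0 Hd] := (continuous_normP _ _).1 (@hBcont i j x0) 1 ltr01.
  have [Bij|Bij] := eqVneq (B x0 i j) 0.
    apply: (near_normP x0 _).2; exists d => // x xd; split => //.
    have := Hd x xd; have := be_ge i j; rewrite Bij normr0 subr0; lra.
  have e0 : 0 < `|B x0 i j| / 2 by rewrite divr_gt0// normr_gt0.
  have [l l0 Hl] := (continuous_normP _ _).1 (@hBcont i j x0) _ e0.
  apply: (near_normP x0 _).2; exists (Num.min d l); first by rewrite lt_min d0.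
  move=> x; rewrite lt_min => /andP[xd xl].
  have h1 := Hd x xd; have h2 := Hl x xl; split=> [_|].
    apply: le_trans (th_le i j Bij) _.
    have := ler_normB (B x i j) (B x i j - B x0 i j).
    by rewrite opprB addrC subrK; lra.
  have := ler_normD (B x i j - B x0 i j) (B x0 i j); rewrite subrK.
  have := be_ge i j; lra.
exists (C1 + m%:R * (be * C1)); first by rewrite addr_ge0// !mulr_ge0.
apply: filterS2 HC0 Bnear => x HC0 HB w sw.
have diff i j : w i x - w j x <= C1.
  apply: (HC1 (B x) (fun i => w i x)) => //.
  - by move=> i' j'; exact: (HB (i', j')).1.
  - by move=> i' j'; exact: (HB (i', j')).2.
  - by move=> i'; exact: HC0.
split=> [i j|i].
  by apply: le_trans (diff i j) _; rewrite lerDl !mulr_ge0.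
have h : - (m%:R * (be * C1)) <= coupling B w x i.
  rewrite coupling_centered -[X in - (X * _)]/(m%:R) -mulrN -[X in X%:R](card_ord m).
  rewrite mulr_natl -sumr_const; apply: ler_sum => j _.
  have h1 : `|B x i j * (w j x - w i x)| <= be * C1.
    rewrite normrM ler_pM//; first exact: (HB (i, j)).2.
    by rewrite ler_norml diff andbT lerNl opprB diff.
  by move: h1; rewrite ler_norml => /andP[].
by apply: le_trans h; rewrite lerN2 lerDr.
Qed.

Lemma uniform_estimate : exists2 C : R, 0 <= C & forall w, subsolutions H B 0 w ->
  forall x, (forall i j, w i x - w j x <= C) /\ (forall i, - C <= coupling B w x i).
Proof.
pose P (S : set V) := exists2 C : R, 0 <= C & forall x, S x ->
  forall w, subsolutions H B 0 w ->
  (forall i j, w i x - w j x <= C) /\ (forall i, - C <= coupling B w x i).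
have [C C0 HC] : P [set x : V | `|x - 0| <= 2^-1].
  apply: compact_ideal; first exact: closed_ball_compact.
  - by exists 0.
  - by move=> S T ST [C C0 HC]; exists C => // x /ST; exact: HC.
  - move=> S T [C C0 HC] [D D0 HD]; exists (Num.max C D); first by rewrite le_max C0.
    move=> x STx w sw.
    suff [E [EC [h1 h2]]] : exists E, E <= Num.max C D /\
        ((forall i j, w i x - w j x <= E) /\ (forall i, - E <= coupling B w x i)).
      split=> [i j|i]; first exact: le_trans (h1 i j) EC.
      by apply: le_trans (h2 i); rewrite lerN2.
    case: STx => [Sx|Tx]; [exists C|exists D]; rewrite le_max lexx ?orbT.
      by split=> //; exact: HC.
    by split=> //; exact: HD.
  - move=> x _; have [C C0 HC] := local_estimate x.
    by eexists; first exact: HC; exists C.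
exists C => // w sw x.
have [z lz xz] := cube_representative x.
have [|h1 h2] := HC (x - z) _ w sw; first by rewrite /= subr0.
have [cw _] := sw.
have wz i : w i (x - z) = w i x by exact: torus_fun_latticeB (cw i).2 lz.
split=> [i j|i]; first by rewrite -!wz.
by rewrite -(coupling_lattice x i cw (latticeN lz)).
Qed.

Lemma euclidean_norm_le (v : V) : euclidean_norm v <= N%:R * `|v|.
Proof.
have Nv : 0 <= N%:R * `|v| by rewrite mulr_ge0.
rewrite -[leRHS]ger0_norm// -sqrtr_sqr ler_wsqrtr// exprMn.
apply: (@le_trans _ _ (N%:R * `|v| ^+ 2)).
  rewrite -[X in X%:R](card_ord N) mulr_natl -sumr_const; apply: ler_sum => k _.
  by rewrite -real_normK ?num_real// lerXn2r ?nnegrE// coord_le_norm.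
rewrite ler_wpM2r ?sqr_ge0// -natrX ler_nat.
by case: (N) => // n; rewrite expnS leq_pmulr.
Qed.

Lemma torus_fun_bounded (f : V -> R) : continuous f -> torus_fun f ->
  exists M, forall x, f x <= M.
Proof.
move=> cf tf.
have cK : compact [set x : V | `|x - 0| <= 2^-1] by exact: closed_ball_compact.
have K0 : [set x : V | `|x - 0| <= 2^-1] !=set0.
  by exists 0; rewrite /= subrr normr0 invr_ge0.
have [c _ Hc] := compact_max cK K0 (fun x _ => cf x).
exists (f c) => x; have [z lz xz] := cube_representative x.
by rewrite -(torus_fun_latticeB x tf lz); apply: Hc; rewrite /= subr0.
Qed.

(** The lower bound on the coupling bounds the Hamiltonian from above on the
    momenta of all critical subsolutions, which are thus bounded by
    coercivity. *)
Lemma uniform_lipschitz : exists2 L : R, 0 <= L & forall w, subsolutions H B 0 w ->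
  forall i x y, w i x - w i y <= L * `|x - y|.
Proof.
have [C C0 HC] := uniform_estimate.
have [A A0 HA] : exists2 A : R, 0 <= A &
    forall i x p, H i x p <= C -> euclidean_norm p <= A.
  apply: common_bound => [i c c' cc' h x p hp|i]; first exact: le_trans (h x p hp) cc'.
  by have [A _ HA] := hamiltonian_coercive (hH i) C; exists A.
exists ((A + 1) * N%:R); first by rewrite mulr_ge0// addr_ge0.
move=> w sw i x y; have [cw sw'] := sw.
have [M HM] := torus_fun_bounded (cw i).1 (cw i).2.
have Dw x' p : superdifferential (w i) x' p -> euclidean_norm p <= A.
  move=> Dp; apply: (HA i x').
  have := sw' _ _ _ Dp; have [_ /(_ i)] := HC w sw x'; lra.
apply: le_trans (bounded_superdifferential_lipschitz (cw i).1 HM A0 Dw x y) _.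
rewrite -mulrA ler_wpM2l ?addr_ge0//; exact: euclidean_norm_le.
Qed.

End Estimates.

(** * Suprema and bumps of critical subsolutions *)

Section Perron.
Context {R : realType} {N m : nat}.
Notation V := 'rV[R]_N.
Variables (H : 'I_m -> V -> V -> R) (B : V -> 'M[R]_m).
Hypothesis hH : forall i, convex_hamiltonian (H i).
Hypothesis hBtorus : torus_fun B.
Hypothesis hBcont : forall i j, continuous (fun x => B x i j).
Hypothesis hBdeg : forall x, degenerate_coupling_matrix (B x).
Hypothesis hBirr : forall x, irreducible_matrix (B x).
Implicit Types (u v w : 'I_m -> V -> R) (x y z p : V).

Lemma coupling_antimonotone u w x i : (forall j, u j x <= w j x) -> w i x = u i x ->
  coupling B w x i <= coupling B u x i.
Proof.
move=> uw wui; rewrite -subr_ge0.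
have [] // := @coupling_ge _ _ _ B hBdeg u w x i 0; last by rewrite wui subrr.
by move=> j; rewrite subr_le0.
Qed.

(** Let [phi] test the supremum [U] at [x0]. A member [w] of [S] which is almost
    optimal at [x0] has an approximate maximum of [w i - phi] there, so that
    [perturbed_max] gives a momentum of [w i] close to that of [phi]. The
    coupling of [w] is not much below that of [U]: the off-diagonal terms have
    the right sign since [w <= U], and the diagonal term is small because
    [U i - w i], small at [x0], is Lipschitz with a constant that does not
    depend on [w]. *)
Lemma sup_subsolution (S : set ('I_m -> V -> R)) :
  S `<=` subsolutions H B 0 -> S !=set0 ->
  (forall i x, has_ubound [set w i x | w in S]) ->
  subsolutions H B 0 (fun i x => sup [set w i x | w in S]).
Proof.
move=> SH S0 Sb; pose U i x := sup [set w i x | w in S].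
have [L L0 HL] := uniform_lipschitz hH hBtorus hBcont hBdeg hBirr.
have img0 i x : [set w i x | w in S] !=set0.
  by have [w Sw] := S0; exists (w i x), w.
have le_U w i x : S w -> w i x <= U i x.
  by move=> Sw; apply: sup_upper_bound; [split|exists w].
have U_lip i x y : U i x - U i y <= L * `|x - y|.
  rewrite lerBlDr; apply: ge_sup => // _ [w Sw <-].
  have := HL w (SH w Sw) i x y; have := le_U w i y Sw; lra.
have cU i : continuous (U i).
  move=> x; apply/continuous_normP => e e0; exists (e / (L + 1)).
    by rewrite divr_gt0// ltr_wpDl.
  move=> y; rewrite ltr_pdivlMr ?ltr_wpDl// => yx.
  have h : L * `|y - x| <= `|y - x| * (L + 1) by rewrite mulrC ler_wpM2l// lerDl.
  have := U_lip i y x; have := U_lip i x y; rewrite (distrC x) ltr_norml => h1 h2.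
  by apply/andP; split; lra.
split=> [i|x0 i P [phi [Cphi /near_normP[r r0 Hr] PE]]].
  split=> [|k x]; first exact: cU.
  congr sup; apply/seteqP; split=> _ [w Sw <-]; exists w => //;
  by have [cw _] := SH w Sw; rewrite (cw i).2.
apply/ler_addgt0Pr => e' e'0; rewrite add0r.
pose be := `|B x0 i i| + 1.
have be0 : 0 < be by rewrite ltr_wpDl.
pose e := e' / (2 + 2 * be).
have bb0 : 0 < 2 + 2 * be by lra.
have e0 : 0 < e by rewrite divr_gt0.
have [d1 d10 H1] := hamiltonian_uniform (hH i) x0 `|P| e0.
have cUc : continuous (fun x => coupling B U x i) by exact: coupling_continuous.
have [d2 d20 H2] := (continuous_normP _ _).1 (cUc x0) e e0.
have [d3 d30 H3] := (continuous_normP _ _).1 (@hBcont i i x0) 1 ltr01.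
pose d := Num.min (Num.min d1 d2) (Num.min d3 (e / (2 * L + 1))).
have L1 : 0 < 2 * L + 1 by lra.
have d0 : 0 < d by rewrite !lt_min d10 d20 d30 divr_gt0.
have r20 : 0 < r / 2 by lra.
have [l l0 Hl] := perturbed_max Cphi d0 r20.
have le0 : 0 < Num.min l e by rewrite lt_min l0.
have [_ [w Sw <-] wU] := sup_adherent le0 (conj (img0 i x0) (Sb i x0)).
rewrite -/(U i x0) in wU.
have [wl we] : U i x0 - l < w i x0 /\ U i x0 - e < w i x0.
  by move: wU; rewrite ltrBlDr -ltrBlDl lt_min => /andP[h1 h2]; split; lra.
have [cw sw] := SH w Sw.
have [y yr|x [p [xd Dp pP]]] := Hl (w i) (cw i).1.
  have := Hr y ltac:(lra); have := le_U w i y Sw.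
  rewrite -!/(U _ _); lra.
move: xd; rewrite !lt_min => /andP[/andP[x1 x2] /andP[x3 x4]].
move: pP; rewrite !lt_min -PE => /andP[/andP[p1 _] _].
have x00 : `|x0 - x0| < d1 by rewrite subrr normr0.
have := H1 x0 x P p x00 x1 (lexx _) p1; rewrite ltr_norml => /andP[_ HH].
have := H2 x x2; rewrite ltr_norml => /andP[CC _].
have wsub := sw x i p Dp.
have gap0 : 0 <= U i x - w i x by rewrite subr_ge0; exact: le_U.
have gap : U i x - w i x <= 2 * e.
  have h1 := U_lip i x x0; have h2 := HL w (SH w Sw) i x0 x.
  rewrite distrC in h2.
  have : (2 * L + 1) * `|x - x0| <= e by rewrite mulrC -ler_pdivlMr// ltW.
  have := normr_ge0 (x - x0); lra.
have bii : B x i i <= be.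
  have := H3 x x3; rewrite ltr_norml => /andP[_ h]; have := ler_norm (B x0 i i).
  rewrite /be; lra.
have cgap : coupling B U x i - coupling B w x i <= be * (2 * e).
  rewrite (coupling_diff hBdeg _ _ _ _ 0) (bigD1 i)//= subr0.
  rewrite -[leRHS]addr0 lerD//.
    apply: (@le_trans _ _ (be * (U i x - w i x))).
      by rewrite ler_wpM2r.
    by rewrite ler_wpM2l// ltW.
  apply: sumr_le0 => j ji; rewrite subr0 mulr_le0_ge0 ?(B_offdiag hBdeg)//.
  by rewrite subr_ge0; exact: le_U.
have e'E : e' = (2 + 2 * be) * e by rewrite /e mulrC divfK// gt_eqF.
rewrite -[coupling B _ x0 i]/(coupling B U x0 i); lra.
Qed.

Lemma dist_max0 (a b : R) : `|Num.max 0 a - Num.max 0 b| <= `|a - b|.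
Proof.
case: (leP 0 a) => a0; case: (leP 0 b) => b0 //.
- rewrite subr0 !ger0_norm//; lra.
- rewrite sub0r normrN (ger0_norm b0) ler0_norm; lra.
- by rewrite subrr normr0.
Qed.

(** The graph of [f + g] is, near [y], the upper envelope of those of [f] and of
    [psi]: the test function [phi], lowered by [sqdist y] so that it falls below
    [f] at some distance from [y], then raised by a small constant. Where [g] is
    positive, [psi] touches [f + g] from below, which determines the momenta of
    [f + g] there. *)
Lemma bump_function (f phi : V -> R) y (d e : R) :
  continuous f -> C1_near phi y ->
  (\forall x \near y, f y - phi y <= f x - phi x) -> 0 < d -> 0 < e ->
  exists g : V -> R,
    [/\ continuous g, (forall x, 0 <= g x <= e), 0 < g y,
        (forall x, d <= `|x - y| -> g x = 0) &
        forall x, 0 < g x -> exists psi : V -> R,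
          [/\ C1_near psi x, psi x = f x + g x,
              (\forall t \near x, psi t <= f t + g t) &
              `|gradient psi x - gradient phi y| < d]].
Proof.
move=> cf Cphi /near_normP[d3 d30 phimin] d0 e0.
have d20 : 0 < d / 2 by lra.
have [d1 d10 H1] := (continuous_normP _ _).1 (C1_near_gradient_continuous Cphi) _ d20.
have [d2 d2_0 H2] := C1_near_ball Cphi.
pose r := Num.min (Num.min (d / 4) d1) (Num.min d2 d3).
have r0 : 0 < r by rewrite !lt_min d10 d2_0 d30 !andbT; lra.
have [rd r1 r2 r3] : [/\ r <= d / 4, r <= d1, r <= d2 & r <= d3].
  by rewrite /r; split; rewrite !ge_min lexx ?orbT.
(* The first bound makes [psi] at most [f] at distance at least [r / 2] from
   [y], so that [g] is continuous. *)
pose a := Num.min ((r / 2) ^+ 2) e.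
have a0 : 0 < a by rewrite lt_min e0 andbT exprn_gt0//; lra.
have [ar ae] : a <= (r / 2) ^+ 2 /\ a <= e by split; rewrite /a ge_min lexx ?orbT.
pose psi : V -> R := phi + (fun x => -1 * sqdist y x) + cst (f y - phi y + a).
have psiE x : psi x = phi x - sqdist y x + (f y - phi y + a).
  by rewrite -[psi x]/(phi x + -1 * sqdist y x + (f y - phi y + a)) mulN1r.
have C1phi x : `|x - y| < r -> C1_near phi x.
  by move=> xr; apply: H2; apply: le_trans (ltW xr) r2.
have Cpsi1 x : `|x - y| < r -> C1_near (phi + (fun x => -1 * sqdist y x)) x.
  by move=> xr; apply: C1_nearD; [exact: C1phi|exact/C1_nearZ/C1_near_sqdist].
have Cpsi x : `|x - y| < r -> C1_near psi x.
  by move=> xr; apply: C1_nearD; [exact: Cpsi1|exact: C1_near_cst].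
have gpsi x : `|x - y| < r -> gradient psi x = gradient phi x - 2 *: (x - y).
  move=> xr; rewrite gradientD; last 2 first.
  - exact/C1_near_differentiable/Cpsi1.
  - exact: differentiable_cst.
  rewrite gradientD; last 2 first.
  - exact/C1_near_differentiable/C1phi.
  - exact/C1_near_differentiable/C1_nearZ/C1_near_sqdist.
  rewrite gradientZ; last exact: differentiable_sqdist.
  by rewrite gradient_sqdist gradient_cst addr0 scaleN1r.
have psi_le x : `|x - y| < r -> psi x - f x <= a - sqdist y x.
  by move=> xr; have := phimin x (lt_le_trans xr r3); rewrite psiE; lra.
pose g x := if `|x - y| < r then Num.max 0 (psi x - f x) else 0.
have g_far x : r / 2 <= `|x - y| -> g x = 0.
  move=> xr; rewrite /g; case: ifP => // xr'; apply/max_idPl.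
  apply: le_trans (psi_le x xr') _; rewrite subr_le0.
  apply: le_trans ar (le_trans _ (sqr_norm_le_sqdist y x)).
  by rewrite lerXn2r// nnegrE; lra.
have cD x : `|x - y| < r -> {for x, continuous (fun x => psi x - f x)}.
  move=> xr; apply: continuousB; last exact: cf.
  exact/differentiable_continuous/C1_near_differentiable/Cpsi.
have near_r x : `|x - y| < r -> exists2 s : R, 0 < s &
    forall t, `|t - x| < s -> `|t - y| < r.
  move=> xr; exists (r - `|x - y|) => [|t tx]; first by rewrite subr_gt0.
  by rewrite -(subrK x t) -addrA; apply: le_lt_trans (ler_normD _ _) _; lra.
exists g; split.
- move=> x; have [xr|xr] := ltP `|x - y| r.
    apply/continuous_normP => b b0.
    have [l l0 Hl] := (continuous_normP _ _).1 (cD x xr) b b0.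
    have [s s0 Hs] := near_r x xr.
    exists (Num.min l s); first by rewrite lt_min l0.
    move=> t; rewrite lt_min => /andP[tl ts].
    by rewrite /g xr Hs//; apply: le_lt_trans (dist_max0 _ _) (Hl t tl).
  apply/continuous_normP => b b0; exists (r / 2); first lra.
  move=> t tx; rewrite !g_far ?subrr ?normr0//; first lra.
  have := ler_normD (x - t) (t - y); rewrite addrA subrK (distrC x t); lra.
- move=> x; rewrite /g; case: ifP => xr; last by rewrite lexx ltW.
  rewrite le_max lexx ge_max (ltW e0) /=; apply: le_trans (psi_le x xr) _.
  by have := sqdist_ge0 y x; lra.
- rewrite /g subrr normr0 r0 lt_max; apply/orP; right.
  by rewrite psiE sqdistxx; lra.
- by move=> x xd; apply: g_far; lra.
- move=> x gx.
  have xr : `|x - y| < r.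
    by rewrite ltNge; apply/negP => h; move: gx; rewrite g_far ?ltxx//; lra.
  have [s s0 Hs] := near_r x xr.
  exists psi; split.
  + exact: Cpsi.
  + by move: gx; rewrite /g xr; case: (leP 0 (psi x - f x)) => _; lra.
  + apply: (near_normP x _).2; exists s; first exact: s0.
    by move=> t ts; rewrite /g Hs// -lerBlDl le_max lexx orbT.
  + rewrite gpsi// addrAC; apply: le_lt_trans (ler_normD _ _) _.
    rewrite normrN normrZ ger0_norm//.
    by have := H1 x (lt_le_trans xr r1); lra.
Qed.

(** The [i]-th component is raised by a [bump_function] repeated around all the
    integer translates of [y]. Where it is larger than [u i], its momentum is
    almost that of the test function at [y], so that the [i]-th inequality is
    strict by continuity; in the other equations, raising [w i] decreases the
    coupling. *)
Lemma perron_bump u i y p : subsolutions H B 0 u -> subdifferential (u i) y p ->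
  H i y p + coupling B u y i < 0 ->
  exists w, [/\ subsolutions H B 0 w, (forall j x, u j x <= w j x),
    (forall j x, j != i -> w j x = u j x), u i y < w i y &
    forall x, u i x < w i x -> strict_at H B w i x].
Proof.
move=> sol_u [phi [Cphi phimin ->]]; set P := gradient phi y => neg.
have [cu su] := sol_u.
(* A quarter of the defect: passing to a nearby momentum, to a nearby point and
   from [u i] to [w i] costs at most [s] each, and a margin [s] is left. *)
pose s := - (H i y P + coupling B u y i) / 4.
have s0 : 0 < s by rewrite divr_gt0// oppr_gt0.
have sE : H i y P + coupling B u y i = - 4 * s by rewrite /s; field.
have [d1 d10 H1] := hamiltonian_uniform (hH i) y `|P| s0.
have cuc : continuous (fun x => coupling B u x i).
  by apply: coupling_continuous => // j; exact: (cu j).1.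
have [d2 d20 H2] := (continuous_normP _ _).1 (cuc y) s s0.
have [d3 d30 H3] := (continuous_normP _ _).1 (@hBcont i i y) 1 ltr01.
pose be := `|B y i i| + 1.
have be0 : 0 < be by rewrite ltr_wpDl.
pose d := Num.min (Num.min 4^-1 d1) (Num.min d2 d3).
have d0 : 0 < d by rewrite !lt_min d10 d20 d30 invr_gt0 ltr0n.
have [da db dc dd] : [/\ d <= 4^-1, d <= d1, d <= d2 & d <= d3].
  by rewrite /d; split; rewrite !ge_min lexx ?orbT.
have [g [cg g_itv gy g_far g_touch]] :=
  bump_function (cu i).1 Cphi phimin d0 (divr_gt0 s0 be0).
have g_ge0 x : 0 <= g x by have /andP[] := g_itv x.
pose G x := g (x - round y x).
have cG : continuous G by exact: periodize_continuous da cg g_far.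
have tG : torus_fun G.
  move=> k x; rewrite /G round_lattice.
    by rewrite opprD addrACA subrr addr0.
  by move=> l; rewrite mxE; case: (_ && _); rewrite ?rpred0 ?rpred1.
pose w j x := u j x + (if j == i then G x else 0).
have wi x : w i x = u i x + G x by rewrite /w eqxx.
have wj j : j != i -> w j = u j.
  by move=> /negbTE ji; apply/funext => x; rewrite /w ji addr0.
have uw j x : u j x <= w j x by rewrite lerDl; case: ifP => // _; exact: g_ge0.
have cwi j : continuous (w j) /\ torus_fun (w j).
  have [->|ji] := eqVneq j i; last by rewrite wj.
  have -> : w i = (fun x => u i x + G x) by apply/funext => x; exact: wi.
  split=> [x|k x]; last by rewrite tG (cu i).2.
  exact: (continuousD ((cu i).1 x) (cG x)).
have key x : u i x < w i x -> sub_at H B w i (- s) x.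
  rewrite wi ltrDl /G => Gx q Dq; set z := round y x in Gx; pose t := x - z.
  have lz : lattice z by exact: lattice_round.
  rewrite -/t in Gx.
  have td : `|t - y| < d.
    by rewrite ltNge; apply/negP => h; move: Gx; rewrite g_far// ltxx.
  have [psi [Cpsi psit psi_le dpsi]] := g_touch t Gx.
  have ut j : u j t = u j x by exact: torus_fun_latticeB (cu j).2 lz.
  have Bt : B t = B x by exact: torus_fun_latticeB hBtorus lz.
  have qE : q = gradient psi t.
    rewrite -(gradient_shift (C1_near_differentiable Cpsi)).
    apply: superdifferential_touching Dq.
    - exact: (C1_near_shift Cpsi).
    - by rewrite wi /G -/z -/t psit ut.
    have [r r0 Hr] := (near_normP t _).1 psi_le.
    apply: (near_normP x _).2; exists (Num.min r 4^-1).
      by rewrite lt_min r0 invr_gt0 ltr0n.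
    move=> x'; rewrite lt_min => /andP[x'r x'4].
    have x't : x' - z - t = x' - x by rewrite /t opprB addrA subrK.
    (* [x'] is near enough to [x] to be rounded to the same lattice point. *)
    have rE : round y x' = z.
      apply/subr0_eq; rewrite -round_lattice; last exact: latticeN.
      apply: round_near.
      have -> : x' - z - y = (x' - x) + (t - y) by rewrite -x't addrA subrK.
      by apply: le_lt_trans (ler_normD _ _) _; lra.
    rewrite wi /G rE -(torus_fun_latticeB x' (cu i).2 lz).
    by apply: Hr; rewrite x't.
  have Ht : H i x q = H i t q.
    by have [tH _ _ _] := hH i; rewrite (torus_fun_latticeB x (tH q) lz).
  have yy : `|y - y| < d1 by rewrite subrr normr0.
  rewrite -/P -qE in dpsi.
  have := H1 y t P q yy (lt_le_trans td db) (lexx _) (lt_le_trans dpsi db).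
  rewrite ltr_norml => /andP[h1 _].
  have := H2 t (lt_le_trans td dc); rewrite ltr_norml => /andP[_ h2].
  have cwE : coupling B w x i - coupling B u t i = B t i i * g t.
    have -> : coupling B u t i = coupling B u x i.
      by rewrite /coupling Bt; apply: eq_bigr => j _; rewrite ut.
    rewrite (coupling_diff hBdeg _ _ _ _ 0) (bigD1 i)//= big1 => [|j ji].
      by rewrite wi /G -/z -/t Bt; ring.
    by rewrite wj// subrr subr0 mulr0.
  have Bbe : B t i i * g t <= s.
    have h : B t i i <= be.
      have := H3 t (lt_le_trans td dd); rewrite ltr_norml => /andP[_ h].
      have hB := ler_norm (B y i i); rewrite /be.
      clear - h hB; lra.
    have /andP[_ gs] := g_itv t.
    apply: (@le_trans _ _ (be * g t)); first by rewrite ler_wpM2r.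
    by rewrite mulrC -ler_pdivlMr.
  clear - sE Ht h1 h2 cwE Bbe; lra.
have sw : subsolutions H B 0 w.
  split=> [|x j q Dq]; first exact: cwi.
  have [ji|ji] := eqVneq j i; last first.
    have uwx := coupling_antimonotone (fun l => uw l x) (congr1 (fun f => f x) (wj j ji)).
    rewrite (wj j ji) in Dq; apply: le_trans (su x j q Dq).
    by rewrite lerD2l.
  subst j; have [h|h] := ltP (u i x) (w i x).
    by apply: le_trans (key x h q Dq) _; rewrite oppr_le0 ltW.
  have wu : w i x = u i x by apply/eqP; rewrite eq_le h uw.
  have uwx := coupling_antimonotone (fun l => uw l x) wu.
  have Dq' : superdifferential (u i) x q.
    apply: superdifferential_le Dq => //.
    by apply: (near_normP x _).2; exists 1.
  by apply: le_trans (su x i q Dq'); rewrite lerD2l.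
exists w; split=> //.
- by move=> j x ji; rewrite wj.
- have r0y : round y y = 0 by apply: round_near; rewrite subrr normr0 invr_gt0.
  by rewrite wi ltrDl /G r0y subr0.
- move=> x uwx; exists s => //.
  have cD : {for x, continuous (fun x => w i x - u i x)}.
    apply: continuousB; [exact: (cwi i).1|exact: (cu i).1].
  have D0 : 0 < w i x - u i x by rewrite subr_gt0.
  have [r r0 Hr] := (continuous_normP _ _).1 cD _ D0.
  apply: (near_normP x _).2; exists r => // x' xx'; apply: key.
  have := Hr x' xx'; rewrite ltr_norml => /andP[h _].
  clear - h; lra.
Qed.

End Perron.

(** * The Aubry set, comparison and existence *)

Section Aubry.
Context {R : realType} {N m : nat}.
Notation V := 'rV[R]_N.
Variables (H : 'I_m -> V -> V -> R) (B : V -> 'M[R]_m).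
Hypothesis hH : forall i, convex_hamiltonian (H i).
Hypothesis hBtorus : torus_fun B.
Hypothesis hBcont : forall i j, continuous (fun x => B x i j).
Hypothesis hBdeg : forall x, degenerate_coupling_matrix (B x).
Hypothesis hBirr : forall x, irreducible_matrix (B x).
Implicit Types (u v w : 'I_m -> V -> R) (x y z p : V).

Lemma Phi_has_ubound i k y x :
  has_ubound [set v i x - v k y | v in subsolutions H B 0].
Proof.
have [C C0 HC] := uniform_estimate hH hBtorus hBcont hBdeg hBirr.
have [L L0 HL] := uniform_lipschitz hH hBtorus hBcont hBdeg hBirr.
exists (L * `|x - y| + C) => _ [v sv <-].
have := HL v sv i x y; have := (HC v sv y).1 i k; lra.
Qed.

Lemma Phi_ge v i k y x : subsolutions H B 0 v -> v i x - v k y <= Phi H B i k y x.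
Proof.
move=> sv; apply: sup_upper_bound; last by exists v.
by split; [exists (v i x - v k y), v|exact: Phi_has_ubound].
Qed.

Lemma Phi_diag k y : subsolutions H B 0 !=set0 -> Phi H B k k y y = 0.
Proof.
move=> [v sv]; rewrite /Phi.
have -> : [set v k y - v k y | v in subsolutions H B 0] = [set 0].
  by apply/seteqP; split=> [_ [w _ <-]|_ ->]; [rewrite /= subrr|exists v => //; rewrite subrr].
by rewrite sup1.
Qed.

Lemma Phi_subsolution k y : subsolutions H B 0 !=set0 ->
  subsolutions H B 0 (fun i x => Phi H B i k y x).
Proof.
move=> [v0 sv0].
pose S := [set (fun i x => v i x + - v k y) | v in subsolutions H B 0].
have E i x : [set w i x | w in S] = [set v i x - v k y | v in subsolutions H B 0].
  apply/seteqP; split=> [_ [_ [v sv <-] <-]|_ [v sv <-]]; first by exists v.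
  by exists (fun i x => v i x + - v k y) => //; exists v.
have -> : (fun i x => Phi H B i k y x) = (fun i x => sup [set w i x | w in S]).
  by apply/funext => i; apply/funext => x; rewrite E.
apply: sup_subsolution => //.
- by move=> _ [v sv <-]; exact: subsolutions_addC.
- by exists (fun i x => v0 i x + - v0 k y); exists v0.
- by move=> i x; rewrite E; exact: Phi_has_ubound.
Qed.

Lemma not_supersolution u : continuous_torus_tuple u -> ~ supersolutions H B 0 u ->
  exists i x p, subdifferential (u i) x p /\ H i x p + coupling B u x i < 0.
Proof.
move=> cu nsu; apply: contrapT => nex; apply: nsu; split=> // x i p Dp.
by rewrite leNgt; apply/negP => neg; apply: nex; exists i, x, p.
Qed.

(** Among the critical subsolutions whose [k]-th component vanishes at [y], the
    largest is [fun i x => Phi H B i k y x]. Hence its bump raises the [k]-th component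
    at [y], and is strict there. *)
Lemma not_aubry_strict k y : subsolutions H B 0 !=set0 -> ~ aubry_set H B k y ->
  exists2 w, subsolutions H B 0 w & strict_at H B w k y.
Proof.
move=> H0 nA; have sub := Phi_subsolution k y H0.
have [|i [x [p [Dp neg]]]] := not_supersolution sub.1.
  by move=> sup; apply: nA; split.
have [w [sw uw wu uwx strict]] := perron_bump hH hBtorus hBcont hBdeg sub Dp neg.
exists w => //.
have [h|h] := ltP (Phi H B k k y y) (w k y).
  have [ki|ki] := eqVneq k i; last by move: h; rewrite wu// ltxx.
  by subst i; exact: strict.
have := Phi_ge i k y x sw.
rewrite (Phi_diag k y H0) in h; lra.
Qed.

(** Up to the constant [w k y], the subsolution [w] is below
    [fun i x => Phi H B i k y x], with contact at the index [k] and the point [y]. If the latter is a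
    solution, then [contact_propagation] forbids strictness at every index. *)
Lemma strict_not_aubry k i y w : subsolutions H B 0 w -> strict_at H B w i y ->
  ~ aubry_set H B k y.
Proof.
move=> sw st [_ sup].
have [] := @contact_propagation _ _ _ H B hH hBcont hBdeg hBirr w _ (w k y) y k sw sup _ _ i.
- apply: (near_normP y _).2; exists 1 => // x _ j.
  by have := Phi_ge j k y x sw; lra.
- by rewrite Phi_diag ?subr0//; exists w.
- by move=> _; apply.
Qed.

Lemma sub_at_lattice w i (a : R) x z : continuous_torus_tuple w -> lattice z ->
  sub_at H B w i a (x - z) -> sub_at H B w i a x.
Proof.
move=> cw lz sw p [phi [Cphi phimax pE]].
have [tH _ _ _] := hH i.
rewrite -(torus_fun_latticeB x (tH p) lz) -(coupling_lattice hBtorus x i cw (latticeN lz)).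
have xz : x - z - - z = x by rewrite opprK subrK.
apply: sw; exists (fun y => phi (y - - z)); split.
- by apply: C1_near_shift; rewrite xz.
- have [d d0 Hd] := (near_normP _ _).1 phimax.
  apply: (near_normP _ _).2; exists d => // y yd.
  rewrite xz (torus_fun_latticeB x (cw i).2 lz).
  have := Hd (y - - z); rewrite (torus_fun_latticeB y (cw i).2 (latticeN lz)).
  have -> : y - - z - x = y - (x - z) by rewrite opprK opprB addrA.
  by apply.
- by rewrite gradient_shift xz//; exact: C1_near_differentiable.
Qed.

(** Working with pairs of an index and a point lets [strictableU] gather
    equations as well as regions. *)
Definition strictable (D : set ('I_m * V)) : Prop :=
  exists w (d : R), [/\ subsolutions H B 0 w, 0 < d &
    forall i x, D (i, x) -> \forall y \near x, sub_at H B w i (- d) y].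

Lemma strictable0 : subsolutions H B 0 !=set0 -> strictable set0.
Proof. by move=> [w sw]; exists w, 1. Qed.

Lemma strictable_sub D D' : D `<=` D' -> strictable D' -> strictable D.
Proof.
by move=> DD [w [d [sw d0 Hd]]]; exists w, d; split => // i x /DD; exact: Hd.
Qed.

(** The half-sum of two critical subsolutions keeps half of the strictness of
    each of them. *)
Lemma strictableU D D' : strictable D -> strictable D' -> strictable (D `|` D').
Proof.
move=> [w [d [sw d0 Hd]]] [w' [d' [sw' d'0 Hd']]].
have h0 : 0 < (2^-1 : R) by rewrite invr_gt0.
have h1 : (2^-1 : R) < 1 by lra.
exists (fun j y => 2^-1 * w j y + (1 - 2^-1) * w' j y), (Num.min d d' / 2).
split; [exact: subsolutions_comb|by rewrite divr_gt0// lt_min d0|].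
have cw j : continuous (w j) by exact: (sw.1 j).1.
have cw' j : continuous (w' j) by exact: (sw'.1 j).1.
have md : Num.min d d' <= d by rewrite ge_min lexx.
have md' : Num.min d d' <= d' by rewrite ge_min lexx orbT.
have near_sub v i x : subsolutions H B 0 v -> \forall y \near x, sub_at H B v i 0 y.
  by move=> [_ sv]; apply: (near_normP x _).2; exists 1 => // y _ q; exact: sv.
have comb i x a a' : (\forall y \near x, sub_at H B w i a y) ->
    (\forall y \near x, sub_at H B w' i a' y) ->
    2^-1 * a + (1 - 2^-1) * a' <= - (Num.min d d' / 2) ->
    \forall y \near x, sub_at H B (fun j y => 2^-1 * w j y + (1 - 2^-1) * w' j y)
       i (- (Num.min d d' / 2)) y.
  move=> /near_near_sub_at/near_normP[r r0 Hr] /near_near_sub_at/near_normP[s s0 Hs] le.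
  apply: (near_normP x _).2; exists (Num.min r s); first by rewrite lt_min r0.
  move=> y; rewrite lt_min => /andP[yr ys] p Dp.
  by apply: le_trans le; apply: (sub_at_comb hH hBcont cw cw' h0 h1 (Hr y yr) (Hs y ys)).
move=> i x [Dx|Dx].
  by apply: (comb _ _ _ _ (Hd i x Dx) (near_sub w' i x sw')); lra.
by apply: (comb _ _ _ _ (near_sub w i x sw) (Hd' i x Dx)); lra.
Qed.

Lemma strictable_compact (K : set V) (D : set V) i : compact K ->
  subsolutions H B 0 !=set0 ->
  (forall x, K x -> exists2 U, nbhs x U & strictable [set ix | ix.1 = i /\ (U `&` D) ix.2]) ->
  strictable [set ix | ix.1 = i /\ (K `&` D) ix.2].
Proof.
move=> cK H0 loc.
apply: (@compact_ideal V K (fun S => strictable [set ix | ix.1 = i /\ (S `&` D) ix.2])) => //.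
- by apply: strictable_sub (strictable0 H0) => -[j x] [_ []].
- move=> S T ST; apply: strictable_sub => -[j x] /= [ji [Sx Dx]].
  by split=> //; split=> //; exact: ST.
- move=> S T /strictableU SU /SU; apply: strictable_sub => -[j x] /= [ji [[Sx|Tx] Dx]].
    by left.
  by right.
Qed.

Lemma strict_at_strictable w i x (D : set V) : subsolutions H B 0 w ->
  strict_at H B w i x ->
  exists2 U, nbhs x U & strictable [set ix | ix.1 = i /\ (U `&` D) ix.2].
Proof.
move=> sw [d d0 /near_near_sub_at Hd]; eexists; first exact: Hd.
by exists w, d; split => // j y [/= -> [h _]].
Qed.

(** If it were empty, there would be a critical subsolution strict in the [k]-th
    equation at each point, so that by [strict_not_aubry] all the Aubry sets
    would be empty, whatever the index. Thus every equation could be made strict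
    at every point; gathering these strict subsolutions over all indices and the
    unit cube gives a subsolution for a negative constant. *)
Lemma aubry_set_nonempty k : critical_value H B = 0%:E ->
  subsolutions H B 0 !=set0 -> aubry_set H B k !=set0.
Proof.
move=> hc H0; apply: contrapT => nA.
have nA' y i : ~ aubry_set H B i y.
  have [w sw st] : exists2 w, subsolutions H B 0 w & strict_at H B w k y.
    by apply: not_aubry_strict => // Ay; apply: nA; exists y.
  exact: strict_not_aubry st.
pose K := [set x : V | `|x - 0| <= 2^-1].
have cK : compact K by exact: closed_ball_compact.
have all_i (s : seq 'I_m) : strictable [set ix | ix.1 \in s /\ K ix.2].
  elim: s => [|i s IH]; first by apply: strictable_sub (strictable0 H0) => -[j x] [].
  have one : strictable [set ix | ix.1 = i /\ (K `&` setT) ix.2].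
    apply: strictable_compact => // x _.
    have [w sw st] := not_aubry_strict H0 (nA' x i).
    exact: strict_at_strictable st.
  apply: strictable_sub (strictableU one IH) => -[j x] /= [].
  by rewrite inE => /orP[/eqP ->|js] Kx; [left|right].
have [w [d [[cw sw] d0 Hd]]] := all_i (enum 'I_m).
have : subsolutions H B (- d) w.
  split=> // x i; have [z lz xz] := cube_representative x.
  suff : sub_at H B w i (- d) x by [].
  apply: (sub_at_lattice cw lz); apply: nbhs_singleton; apply: Hd.
  by rewrite /= mem_enum /K /= subr0.
move=> wd; have : (critical_value H B <= (- d)%:E)%E.
  by apply: ereal_inf_lbound; exists (- d) => //; exists w.
by rewrite hc lee_fin; lra.
Qed.

Lemma torus_tuple_max (d : 'I_m -> V -> R) (k : 'I_m) : continuous_torus_tuple d ->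
  exists i0 x0, `|x0| <= 2^-1 /\ forall i x, d i x <= d i0 x0.
Proof.
move=> cd.
have cK : compact [set x : V | `|x - 0| <= 2^-1] by exact: closed_ball_compact.
have K0 : [set x : V | `|x - 0| <= 2^-1] !=set0.
  by exists 0; rewrite /= subrr normr0 invr_ge0.
have /choice[c Hc] i : exists c, `|c| <= 2^-1 /\ forall x, d i x <= d i c.
  have [c /= Kc Hc] := compact_max cK K0 (fun x _ => (cd i).1 x).
  exists c; split=> [|x]; first by move: Kc; rewrite subr0.
  have [z lz xz] := cube_representative x.
  by rewrite -(torus_fun_latticeB x (cd i).2 lz); apply: Hc; rewrite /= subr0.
have [i0 _ i0max] := @arg_maxP _ R _ k xpredT (fun i => d i (c i)) isT.
exists i0, (c i0); split=> [|i x]; first exact: (Hc i0).1.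
apply: le_trans ((Hc i).2 x) _; exact: i0max.
Qed.

Lemma torus_tuple_dist u v : continuous_torus_tuple u -> continuous_torus_tuple v ->
  exists2 C : R, 0 <= C & forall i x, `|u i x - v i x| <= C.
Proof.
move=> cu cv; apply: common_bound => [i c c' cc' h x|i].
  exact: le_trans (h x) cc'.
have cuv x : {for x, continuous (fun x => `|u i x - v i x|)}.
  apply: (@continuous_comp _ _ _ (fun x => u i x - v i x) Num.norm).
    by apply: continuousB; [exact: (cu i).1|exact: (cv i).1].
  exact: norm_continuous.
apply: torus_fun_bounded => [x|l x]; first exact: cuv.
by rewrite (cu i).2 (cv i).2.
Qed.

(** Let [M0] be the largest value of the [u i - v i], and suppose that it is
    positive. The points where some [u i - v i] is at least [M0 / 2] are outside
    the Aubry set, and by compactness some critical subsolution [w] is strict in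
    the [k]-th equation at all of them. Mixing a small proportion of [w] into
    [u] yields a subsolution [ut] strict at these points, and the maximum of the
    [ut i - v i] is still attained at one of them: this is a contact at a point
    of strictness. *)
Lemma comparison k u v : subsolutions H B 0 u -> supersolutions H B 0 v ->
  (forall y, aubry_set H B k y -> forall i, u i y <= v i y) ->
  forall i x, u i x <= v i x.
Proof.
move=> su sv uvA i1 x1; rewrite leNgt; apply/negP => uv1.
have [cu _] := su; have [cv _] := sv.
have H0 : subsolutions H B 0 !=set0 by exists u.
have cd w : continuous_torus_tuple w ->
    continuous_torus_tuple (fun i x => w i x - v i x).
  move=> cw i; split=> [x|l x]; last by rewrite (cw i).2 (cv i).2.
  by apply: continuousB; [exact: (cw i).1|exact: (cv i).1].
have [i0 [x0 [_ dmax]]] := torus_tuple_max k (cd u cu).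
set M0 := u i0 x0 - v i0 x0.
have M00 : 0 < M0 by apply: lt_le_trans (dmax i1 x1); rewrite subr_gt0.
pose D := [set x : V | exists i, M0 / 2 <= u i x - v i x].
pose K := [set x : V | `|x - 0| <= 2^-1].
have cK : compact K by exact: closed_ball_compact.
have [w [d [sw d0 Hd]]] : strictable [set ix | ix.1 = k /\ (K `&` D) ix.2].
  apply: strictable_compact => // x _.
  have [Ax|nAx] := pselect (aubry_set H B k x); last first.
    by have [w sw st] := not_aubry_strict H0 nAx; exact: strict_at_strictable st.
  have near_small : \forall y \near x, forall i, u i y - v i y < M0 / 2.
    apply: near_forall_index => i.
    have [r r0 Hr] := (continuous_normP _ _).1 ((cd u cu i).1 x) (M0 / 2) ltac:(lra).
    apply: (near_normP x _).2; exists r => // y yr.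
    have := Hr y yr; rewrite ltr_norml => /andP[_].
    have := uvA x Ax i; lra.
  eexists; first exact: near_small.
  apply: strictable_sub (strictable0 H0) => -[j y] [_ [/= small [i]]].
  by rewrite leNgt small.
have [C C0 HC] := torus_tuple_dist sw.1 cu.
(* As [s * C <= M0 / 8], the mixture [ut] is so close to [u] that the maximum of
   [ut - v] is attained in [D]. *)
pose s := M0 / (8 * (C + M0)).
have CM : 0 < 8 * (C + M0) by lra.
have s0 : 0 < s by rewrite divr_gt0.
have sCM : s * (8 * (C + M0)) = M0 by rewrite /s divfK// gt_eqF.
have sC0 := mulr_ge0 (ltW s0) C0.
have sM0 := mulr_gt0 s0 M00.
have s1 : s < 1 by rewrite /s ltr_pdivrMr// mul1r; lra.
pose t := 1 - s.
have t0 : 0 < t by rewrite /t; lra.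
have t1 : t < 1 by rewrite /t; lra.
pose ut j y := t * u j y + (1 - t) * w j y.
have sut : subsolutions H B 0 ut by exact: subsolutions_comb.
have utE j y : `|ut j y - u j y| <= s * C.
  have -> : ut j y - u j y = s * (w j y - u j y) by rewrite /ut /t; ring.
  by rewrite normrM gtr0_norm// ler_wpM2l// ltW.
have [i2 [x2 [x2K d2max]]] := torus_tuple_max k (cd ut sut.1).
have Dx2 : D x2.
  exists i2; have := utE i2 x2; have := utE i0 x0; have := d2max i0 x0.
  rewrite !ler_norml => h1 /andP[h2 _] /andP[_ h3].
  have M0E : u i0 x0 - v i0 x0 = M0 by [].
  lra.
have sd : strict_at H B w k x2.
  by exists d => //; apply: Hd; split=> //; split=> //; rewrite /K /= subr0.
have cp := @contact_propagation _ _ _ H B hH hBcont hBdeg hBirr ut v _ x2 i2 sut sv _ erefl k.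
have [|_ nst] := cp.
  by apply: (near_normP x2 _).2; exists 1 => // y _ j; exact: d2max.
apply: nst; apply: strict_at_comb => //.
- by move=> j; exact: (cu j).1.
- by move=> j; exact: (sw.1 j).1.
- by apply: (near_normP x2 _).2; exists 1 => // y _ q; exact: su.2.
Qed.

(** The solution is the supremum [U] of the critical subsolutions equal to [v] on
    the Aubry set; it is finite because this set contains some [y0]. If [U] were
    not a supersolution, its bump would be strict where it is larger than [U],
    hence by [strict_not_aubry] equal to [U] on the Aubry set, and it would be
    one of the functions of which [U] is the supremum. *)
Lemma solution_with_trace k v : critical_value H B = 0%:E -> subsolutions H B 0 v ->
  exists u, solutions H B 0 u /\ forall y, aubry_set H B k y -> forall i, u i y = v i y.
Proof.
move=> hc sv; have H0 : subsolutions H B 0 !=set0 by exists v.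
have [y0 Ay0] := aubry_set_nonempty k hc H0.
pose S := [set w | subsolutions H B 0 w /\
  forall y, aubry_set H B k y -> forall i, w i y = v i y].
have Sv : S v by [].
have Sb i x : has_ubound [set w i x | w in S].
  exists (Phi H B i k y0 x + v k y0) => _ [w [sw wv] <-].
  by have := Phi_ge i k y0 x sw; rewrite (wv y0 Ay0); lra.
pose U i x := sup [set w i x | w in S].
have sU : subsolutions H B 0 U.
  by apply: sup_subsolution => //; [move=> w []|exists v].
have UA y : aubry_set H B k y -> forall i, U i y = v i y.
  move=> Ay i; rewrite /U.
  have -> : [set w i y | w in S] = [set v i y].
    by apply/seteqP; split=> [_ [w [_ wv] <-]|_ ->]; [rewrite /= wv|exists v].
  by rewrite sup1.
exists U; split=> //; split=> //; apply: contrapT => nsup.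
have [i [x [p [Dp neg]]]] := not_supersolution sU.1 nsup.
have [w [sw Uw wU Uwx strict]] := perron_bump hH hBtorus hBcont hBdeg sU Dp neg.
have Sw : S w.
  split=> // y Ay j; rewrite -UA//.
  have [->|ji] := eqVneq j i; last exact: wU.
  apply/eqP; rewrite eq_le Uw andbT leNgt; apply/negP => h.
  exact: strict_not_aubry sw (strict y h) Ay.
have : w i x <= U i x.
  by apply: sup_upper_bound; [split=> //; exists (w i x), w|exists w].
lra.
Qed.

End Aubry.

Unset Implicit Arguments.

Theorem theorem5p7 (R : realType) (N m : nat) (hN : (0 < N)%N) (hm : (0 < m)%N)
    (H : 'I_m -> 'rV[R]_N -> 'rV[R]_N -> R)
    (hH : forall i, convex_hamiltonian (H i))
    (B : 'rV[R]_N -> 'M[R]_m)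
    (hBtorus : torus_fun B)
    (hBcont : forall i j, continuous (fun x => B x i j))
    (hBdeg : forall x, degenerate_coupling_matrix (B x))
    (hBirr : forall x, irreducible_matrix (B x))
    (hc : critical_value H B = 0%:E)
    (k : 'I_m)
    (v : 'I_m -> 'rV[R]_N -> R) (hv : subsolutions H B 0 v) :
  exists! u : 'I_m -> 'rV[R]_N -> R,
    solutions H B 0 u /\
    forall y, aubry_set H B k y -> forall i, u i y = v i y.
Proof.
have [u [solu uv]] := solution_with_trace hH hBtorus hBcont hBdeg hBirr k hc hv.
exists u; split=> // u' [solu' u'v].
have cmp := comparison hH hBtorus hBcont hBdeg hBirr (k := k).
apply/funext => i; apply/funext => x; apply/eqP; rewrite eq_le; apply/andP; split.
- by apply: cmp solu.1 solu'.2 _ i x => y Ay j; rewrite uv// u'v.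
- by apply: cmp solu'.1 solu.2 _ i x => y Ay j; rewrite uv// u'v.
Qed.
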